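(* Consider the equation $$\partial_t v(x,t)=Hv(x,t)+a(\theta_t\omega)v(x,t)(1-v(x,t)),\qquad x\in\mathbb{R},\qquad (\ast)$$ (resp. the lattice equation $(\ast\ast)$, which is the same equation with $x\in\mathbb{Z}$, i.e. $\dot u_i=u_{i+1}-2u_i+u_{i-1}+a(\theta_t\omega)u_i(1-u_i)$, $i\in\mathbb{Z}$), where $Hv(x,t)=v(x+1,t)+v(x-1,t)-2v(x,t)$. (1) If $u_1(x,t;\omega)$ and $u_2(x,t;\omega)$ are a bounded sub-solution and a bounded super-solution, respectively, of $(\ast)$ (resp. $(\ast\ast)$) on $[0,T)$, and $u_1(\cdot,0;\omega)\le u_2(\cdot,0;\omega)$, then $u_1(\cdot,t;\omega)\le u_2(\cdot,t;\omega)$ for $t\in[0,T)$, for a.e. $\omega\in\Omega$. (2) Suppose that $u_1(x,t;\omega)$ and $u_2(x,t;\omega)$ are bounded and that for any given $x\in\mathbb{R}$ (resp. $x\in\mathbb{Z}$), $u_1(x,t;\omega)$ and $u_2(x,t;\omega)$ are absolutely continuous in $t\in[0,\infty)$ and satisfy $$\partial_t u_2-\big(Hu_2+a(\theta_t\omega)u_2(1-u_2)\big)>\partial_t u_1-\big(Hu_1+a(\theta_t\omega)u_1(1-u_1)\big)$$ at $(x,t;\omega)$ for (a.e.) $t>0$. Moreover, suppose that $u_2(\cdot,0;\omega)\ge u_1(\cdot,0;\omega)$. Then $u_2(\cdot,t;\omega)>u_1(\cdot,t;\omega)$ for $t>0$, for a.e. $\omega\in\Omega$. (3) If $u_0\in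 l^{\infty,+}(\mathbb{R})$ (resp. $u^0\in l^{\infty,+}(\mathbb{Z})$), then $u(x,t;u_0,\omega)$ (resp. $u(t;u^0,\omega)$) exists and $u(\cdot,t;u_0,\omega)\ge0$ (resp. $u(t;u^0,\omega)\ge0$) for all $t\ge0$.
   Context: Setting: $(\Omega,\mathcal{F},\mathbb{P})$ is a probability space, $\{\theta_t\}_{t\in\mathbb{R}}$ is an ergodic metric dynamical system on it (a jointly measurable, measure-preserving, ergodic flow on $\Omega$), $a:\Omega\to(0,\infty)$ is measurable, and $t\mapsto a(\theta_t\omega)$ is locally H\''older continuous on $\mathbb{R}$ for every $\omega\in\Omega$. Standing assumption: for a.e. $\omega\in\Omega$, $$0<\lim_{r\to\infty}\inf_{t-s\ge r}\frac{1}{t-s}\int_s^t a(\theta_\tau\omega)\,d\tau\le\lim_{r\to\infty}\sup_{t-s\ge r}\frac{1}{t-s}\int_s^t a(\theta_\tau\omega)\,d\tau<\infty.$$ $l^\infty(\mathbb{R})$ (resp. $l^\infty(\mathbb{Z})$) is the space of all bounded functions $u:\mathbb{R}\to\mathbb{R}$ (resp. $u:\mathbb{Z}\to\mathbb{R}$) with the sup norm, and $l^{\infty,+}(\mathbb{R})$ (resp. $l^{\infty,+}(\mathbb{Z})$) is its subset of functions with nonnegative infimum. For $u_0\in l^\infty(\mathbb{R})$ (resp. $u^0\in l^\infty(\mathbb{Z})$), $u(x,t;u_0,\omega)$ (resp. $u(t;u^0,\omega)=\{u_i(t;u^0,\omega)\}_{i\in\mathbb{Z}}$) denotes the unique (a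 priori local in time) solution of $(\ast)$ in $l^\infty(\mathbb{R})$ (resp. of $(\ast\ast)$ in $l^\infty(\mathbb{Z})$) with value $u_0$ (resp. $u^0$) at $t=0$. A function $v(x,t;\omega)$ on $\mathbb{R}\times[0,T)$ (resp. $\mathbb{Z}\times[0,T)$), continuous in $t$, is a super-solution (resp. sub-solution) if for a.e. $\omega\in\Omega$ and any given $x\in\mathbb{R}$ (resp. $x\in\mathbb{Z}$ for the lattice equation), $v(x,t;\omega)$ is absolutely continuous in $t\in[0,T)$ and $v_t\ge Hv+a(\theta_t\omega)v(1-v)$ (resp. $v_t\le Hv+a(\theta_t\omega)v(1-v)$) for (a.e.) $t\in[0,T)$. Boundedness of $u_1,u_2$ means boundedness in $(x,t)$ for given $\omega$. *)

(* Defs.v *)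
From HB Require Import structures.
From mathcomp Require Import all_boot all_order all_algebra.
From mathcomp Require Import all_classical all_reals all_analysis.

Set Implicit Arguments.
Unset Strict Implicit.
Unset Printing Implicit Defensive.

Import Order.TTheory GRing.Theory Num.Theory.
Import numFieldNormedType.Exports.

Local Open Scope classical_set_scope.
Local Open Scope ring_scope.

Record ergodic_mds (R : realType) (d : measure_display)
    (Omega : measurableType d) (P : probability Omega R)
    (theta : R -> Omega -> Omega) : Prop := ErgodicMDS {
  mds_measurable :
    measurable_fun [set: R * Omega] (fun p : R * Omega => theta p.1 p.2) ;
  mds_id : forall w, theta 0 w = w ;
  mds_flow : forall s t w, theta (s + t) w = theta s (theta t w) ;
  mds_preserving :
    forall t A, measurable A -> P (theta t @^-1` A) = P A ;
  mds_ergodic : forall A, measurable A ->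
    (forall t, theta t @^-1` A = A) -> P A = 0%E \/ P A = 1%E }.

Definition locally_hoelder (R : realType) (f : R -> R) : Prop :=
  forall t0 : R, exists alpha C : R, [/\ 0 < alpha, alpha <= 1 &
    \forall s & t \near t0, `|f s - f t| <= C * `|s - t| `^ alpha].

Definition time_mean (R : realType) (f : R -> R) (s t : R) : \bar R :=
  (((t - s)^-1)%:E * \int[lebesgue_measure]_(tau in `[s, t]) (f tau)%:E)%E.

(* The limits below are limits of monotone functions of r, hence they always
   exist in \bar R. *)
Definition lower_mean (R : realType) (f : R -> R) : \bar R :=
  lim (ereal_inf [set time_mean f st.1 st.2 | st in
         [set st : R * R | r <= st.2 - st.1]] @[r --> +oo%R]).

Definition upper_mean (R : realType) (f : R -> R) : \bar R :=
  lim (ereal_sup [set time_mean f st.1 st.2 | st in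
         [set st : R * R | r <= st.2 - st.1]] @[r --> +oo%R]).

Definition abs_cont (R : realType) (a b : R) (f : R -> R) : Prop :=
  forall e : R, 0 < e -> exists2 dl : R, 0 < dl &
    forall (n : nat) (l r : 'I_n -> R),
      (forall i, [/\ a <= l i, l i <= r i & r i <= b]) ->
      trivIset setT (fun i => `]l i, r i[%classic) ->
      \sum_(i < n) (r i - l i) < dl ->
      \sum_(i < n) `|f (r i) - f (l i)| < e.

(* [0, T), with T = +oo allowed. *)
Definition time_dom (R : realType) (T : \bar R) : set R :=
  [set t | 0 <= t /\ (t%:E < T)%E].

(* On a half-open or unbounded interval, absolute continuity is understood on
   each compact subinterval. *)
Definition abs_cont_dom (R : realType) (T : \bar R) (f : R -> R) : Prop :=
  forall b, time_dom T b -> abs_cont 0 b f.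

Definition bounded_dom (R : realType) (X : Type) (T : \bar R)
    (v : X -> R -> R) : Prop :=
  [bounded v p.1 p.2 | p in [set: X] `*` time_dom T].

(* The space variable ranges over a ring X, to be taken to be R for the
   equation on the line and int for the lattice equation. *)
Definition Hop (R : realType) (X : pzRingType) (v : X -> R) (x : X) : R :=
  v (x + 1) + v (x - 1) - 2 * v x.

Definition kpp (R : realType) (X : pzRingType) (c : R) (v : X -> R)
    (x : X) : R :=
  Hop v x + c * v x * (1 - v x).

(* Since derive1 is total, an inequality between time derivatives at t is
   always stated together with the existence of these derivatives at t. *)
Definition super_solution (R : realType) (d : measure_display)
    (Omega : measurableType d) (P : probability Omega R)
    (theta : R -> Omega -> Omega) (a : Omega -> R) (X : pzRingType)
    (T : \bar R) (v : Omega -> X -> R -> R) : Prop :=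
  (forall w x, {within time_dom T, continuous (v w x)}) /\
  \forall w \ae P, forall x : X,
    abs_cont_dom T (v w x) /\
    \forall t \ae lebesgue_measure, time_dom T t ->
      derivable (v w x) t 1 /\
      derive1 (v w x) t >= kpp (a (theta t w)) (v w ^~ t) x.

Definition sub_solution (R : realType) (d : measure_display)
    (Omega : measurableType d) (P : probability Omega R)
    (theta : R -> Omega -> Omega) (a : Omega -> R) (X : pzRingType)
    (T : \bar R) (v : Omega -> X -> R -> R) : Prop :=
  (forall w x, {within time_dom T, continuous (v w x)}) /\
  \forall w \ae P, forall x : X,
    abs_cont_dom T (v w x) /\
    \forall t \ae lebesgue_measure, time_dom T t ->
      derivable (v w x) t 1 /\
      derive1 (v w x) t <= kpp (a (theta t w)) (v w ^~ t) x.

Definition linf (R : realType) (X : Type) : set (X -> R) :=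
  [set u | [bounded u x | x in [set: X]]].

(* Only meaningful on linf. *)
Definition linf_norm (R : realType) (X : Type) (u : X -> R) : R :=
  sup [set `|u x| | x in [set: X]].

Definition linf_pos (R : realType) (X : Type) : set (X -> R) :=
  [set u | linf u /\ 0 <= inf (range u)].

(* u is a solution in l^oo on [0, T) of the (Banach space valued) ODE with
   value u0 at 0: u(.,t) is in l^oo, and the difference quotients converge to
   the right-hand side in the sup norm (one-sided at t = 0). *)
Definition is_solution (R : realType) (X : pzRingType) (A : R -> R)
    (u0 : X -> R) (T : \bar R) (u : X -> R -> R) : Prop :=
  [/\ u ^~ 0 = u0,
      forall t, time_dom T t -> linf (u ^~ t) &
      forall t, time_dom T t ->
        linf_norm (fun x => (u x s - u x t) / (s - t) - kpp (A t) (u ^~ t) x)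
          @[s --> within (time_dom T) t^'] --> (0 : R)].

(* u is the solution of the initial value problem and it exists for all
   t >= 0: it is a solution on [0, oo), and every solution defined a priori
   only on some [0, T) is a restriction of it. *)
Definition is_the_global_solution (R : realType) (X : pzRingType) (A : R -> R)
    (u0 : X -> R) (u : X -> R -> R) : Prop :=
  is_solution A u0 +oo%E u /\
  forall (T : \bar R) (v : X -> R -> R), (0 < T)%E -> is_solution A u0 T v ->
    forall x t, time_dom T t -> v x t = u x t.

(* Main.v *)
Require Import Defs.
From HB Require Import structures.
From mathcomp Require Import all_boot all_order all_algebra.
From mathcomp Require Import all_classical all_reals all_analysis.
From mathcomp Require Import measurable_realfun ring lra.

Import Order.TTheory GRing.Theory Num.Theory.
Import numFieldNormedType.Exports.

Local Open Scope classical_set_scope.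
Local Open Scope ring_scope.

(** The comparison statements rest on a linear maximum principle.  If [u1] is a
    sub-solution, [u2] a super-solution and [w = u2 - u1], then subtracting the
    two inequalities gives, for each [x] and almost every [t],
    [w_t >= w (x + 1) + w (x - 1) + c w] with the coefficient
    [c = a (1 - u1 - u2) - 2] bounded on compact time intervals ([kppB]).  The
    two neighbours enter with a nonnegative sign: if [w >= - M] up to time
    [s + tau], [w >= 0] up to time [s], and [w x] is negative on [(r, t]] with
    [w x r >= 0], then [w_t >= - K M] there for a constant [K], so that
    [w x t >= - K M tau >= - M / 2] once [K tau <= 1 / 2].  Iterating,
    [w >= - B / 2 ^ n] for all [n], hence [w >= 0] up to time [s + tau], and
    steps of this length exhaust the time interval ([linear_comparison],
    [kpp_comparison]).  The argument is pointwise in [x], so the line and the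
    lattice are treated at once, the space variable ranging over any ring.

    The passage from [w_t >= - K M] almost everywhere to an increment of [w]
    is the theorem that an absolutely continuous function with nonnegative
    derivative almost everywhere is nondecreasing ([abs_cont_ndecr]).

    For the strict comparison, [w >= 0] turns the strict inequality into
    [w_t > c w] for a bounded coefficient [c].  If [w] vanished at some time
    [t0 > 0], the same halving argument run backwards from [t0] would make [w]
    vanish on an interval ending at [t0], where [0 = w_t > 0] at almost
    every time ([abs_cont_gt0]).

    For global existence, let [M >= 1] bound the initial value.  Replacing [r]
    by its projection on [[0, M]] in the reaction term makes the equation
    globally Lipschitz on each compact time interval, so Picard iteration
    converges for all times ([picard_solution]).  The linear comparison applied
    to [u] and to [M - u] confines this solution to [[0, M]]
    ([nonneg_solution_exists]), where the truncated and the original equations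
    coincide.  Since its time derivative is bounded uniformly in [x], the right
    hand side is equicontinuous in time, and the pointwise equation holds in the
    sup norm ([kpp_flow_is_solution]).  Conversely a solution in the sup norm
    is bounded and Lipschitz in time on compact intervals, so that comparison
    in both directions gives uniqueness ([solution_le]). *)

(** * Absolutely continuous functions *)

Section AbsoluteContinuity.
Set Implicit Arguments.
Unset Strict Implicit.
Context {R : realType}.
Implicit Types (f g : R -> R) (a b c k x y t : R).

(** Cousin's lemma as an induction principle: instead of a tagged partition
    subordinate to the gauge [rho], the property is carried across each of its
    cells, the tag [c] being allowed to lie anywhere in the cell. *)
Lemma gauge_induction a b (P : R -> Prop) : a <= b -> P a ->
  (forall c, a <= c <= b -> exists2 rho, 0 < rho &
     forall x y, a <= x <= c -> c <= y <= b -> c - rho < x -> y < c + rho ->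
       P x -> P y) ->
  P b.
Proof.
move=> ab Pa step.
pose S := [set x | a <= x <= b /\ P x].
have Sa : S a by split; rewrite ?lexx.
have hS : has_sup S by split; [exists a|exists b => x [/andP[]]].
have ac : a <= sup S by apply: sup_upper_bound.
have cb : sup S <= b by apply: ge_sup; [exists a|move=> x [/andP[]]].
have [|rho rho0 st] := step (sup S); first by rewrite ac.
have [x [/andP[ax xb] Px] cx] := sup_adherent rho0 hS.
have xc : x <= sup S by apply: sup_upper_bound => //; split => //; rewrite ax.
pose y := Num.min b (sup S + rho / 2).
have cy : sup S <= y by rewrite /y le_min cb lerDl divr_ge0// ltW.
have yb : y <= b by rewrite /y ge_min lexx.
have Py : P y.
  apply: (st x) => //; rewrite ?ax ?cy//=.
  by rewrite /y gt_min; apply/orP; right; rewrite ltrD2l gtr_pMr// invf_lt1 ?ltr1n.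
have : y <= sup S.
  by apply: sup_upper_bound => //; split => //; rewrite yb (le_trans ac).
move: Py; rewrite /y minEle; case: ifP => // _ _.
by rewrite gerDl leNgt divr_gt0.
Qed.

Lemma abs_cont_sub a b c e f : a <= c -> e <= b ->
  abs_cont a b f -> abs_cont c e f.
Proof.
move=> ac eb fab eps /fab[dl dl0 H]; exists dl => // n l r lr; apply: H => i.
by have [? ? ?] := lr i; split=> //; [exact: le_trans ac _|exact: le_trans eb].
Qed.

Lemma abs_contB a b f g :
  abs_cont a b f -> abs_cont a b g -> abs_cont a b (fun x => f x - g x).
Proof.
move=> fab gab e e0.
have e20 : 0 < e / 2 by rewrite divr_gt0.
have [d1 d10 H1] := fab _ e20; have [d2 d20 H2] := gab _ e20.
exists (Num.min d1 d2); first by rewrite lt_min d10.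
move=> n l r lr tr; rewrite lt_min => /andP[s1 s2].
rewrite (splitr e) (le_lt_trans _ (ltrD (H1 _ _ _ lr tr s1) (H2 _ _ _ lr tr s2)))//.
rewrite -big_split/=; apply: ler_sum => i _.
have -> : f (r i) - g (r i) - (f (l i) - g (l i)) =
  (f (r i) - f (l i)) - (g (r i) - g (l i)) by ring.
exact: ler_normB.
Qed.

Lemma lipschitz_abs_cont a b k f :
  (forall x y, a <= x -> x <= y -> y <= b -> `|f y - f x| <= k * (y - x)) ->
  abs_cont a b f.
Proof.
move=> lipf e e0; pose K := `|k| + 1.
have K0 : 0 < K by rewrite ltr_wpDl.
exists (e / K); first by rewrite divr_gt0.
move=> n l r lr _; rewrite ltr_pdivlMr// mulrC => sume.
apply: le_lt_trans sume; rewrite mulr_sumr; apply: ler_sum => i _.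
have [al l_r rb] := lr i; apply: le_trans (lipf _ _ al l_r rb) _.
by rewrite ler_wpM2r ?subr_ge0// (le_trans (ler_norm k))// lerDl.
Qed.

Lemma abs_cont_modulus a b f e : abs_cont a b f -> 0 < e ->
  exists2 dl, 0 < dl & forall x y, a <= x -> x <= y -> y <= b -> y - x < dl ->
    `|f y - f x| < e.
Proof.
move=> fab /fab[dl dl0 H]; exists dl => // x y ax xy yb yx.
have := H 1%N (fun=> x) (fun=> y); rewrite !big_ord1; apply=> //.
by move=> i j _ _; rewrite !ord1.
Qed.



Lemma is_derive_near f c df e : is_derive c 1 f df -> 0 < e ->
  exists2 rho, 0 < rho & forall y, `|y - c| < rho ->
    `|f y - f c - df * (y - c)| <= e * `|y - c|.
Proof.
move=> [fd fdf] e0.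
have : h^-1 *: (f (h *: 1 + c) - f c) @[h --> 0^'] --> df by rewrite -fdf.
move=> /cvgrPdist_le/(_ e e0)/=.
move=> /nbhs_ballP[rho/= rho0 H]; exists rho => // y yc.
have [->|yNc] := eqVneq y c; first by rewrite !subrr mulr0 normr0 mulr0 subr0 normr0.
have yc0 : y - c != 0 by rewrite subr_eq0.
have := H (y - c); rewrite /ball/= sub0r normrN => /(_ yc yc0).
rewrite /GRing.scale/= mulr1 subrK => Hy.
have -> : f y - f c - df * (y - c) = - (df - (y - c)^-1 * (f y - f c)) * (y - c).
  by field.
by rewrite normrM normrN ler_wpM2r.
Qed.

Lemma near_is_derive f c df :
  (forall e, 0 < e -> exists2 rho, 0 < rho & forall y, `|y - c| < rho ->
    `|f y - f c - df * (y - c)| <= e * `|y - c|) -> is_derive c 1 f df.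
Proof.
move=> H.
have fdf : h^-1 *: (f (h *: 1 + c) - f c) @[h --> 0^'] --> df.
  apply/cvgrPdist_le => e e0; have [rho rho0 Hr] := H e e0.
  apply/nbhs_ballP; exists rho => //= h; rewrite /ball/= sub0r normrN => hr h0.
  have := Hr (h + c); rewrite addrK => /(_ hr) {}Hr.
  rewrite /GRing.scale/= mulr1 -(@ler_pM2r _ `|h|) ?normr_gt0//.
  rewrite -normrM (le_trans _ Hr)// -normrN le_eqVlt; apply/orP; left; apply/eqP.
  by congr `|_|; field.
by split; [apply/cvg_ex; exists df|apply/cvg_lim].
Qed.

(** An exceptional null set is covered by an open set [U] whose measure is below
    the modulus of absolute continuity.  Cells tagged outside the null set lose
    at most [e'] times their length; cells tagged in it lie in [U], so the
    variations of [f] on them sum to less than [e'].  The end points [a] and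
    [b] are put in the null set because nothing is assumed there. *)
Lemma abs_cont_ndecr a b f : a <= b -> abs_cont a b f ->
  (\forall t \ae lebesgue_measure, a < t < b ->
     derivable f t 1 /\ 0 <= derive1 f t) ->
  f a <= f b.
Proof.
move=> ab fab [N0 [mN0 N00 badN0]].
pose mu := @lebesgue_measure R.
pose N : set R := N0 `|` ([set a] `|` [set b]).
have mN : measurable N by apply: measurableU => //; apply: measurableU.
have N_0 : mu N = 0%E.
  apply/eqP; rewrite eq_le measure_ge0 andbT.
  rewrite (le_trans (measureU2 _ _ _))//; first exact: measurableU.
  rewrite [X in (X + _)%E]N00 add0e.
  have <- : (mu [set a] + mu [set b] = 0)%E.
    by rewrite /mu !lebesgue_measure_set1 adde0.
  exact: measureU2.
have good t : a <= t <= b -> ~ N t -> exists2 df, is_derive t 1 f df & 0 <= df.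
  move=> /andP[at_ tb] Nt.
  have [fd fd0] : derivable f t 1 /\ 0 <= derive1 f t.
    apply: contrapT => H; apply: Nt; rewrite /N/=.
    have [->|ta] := eqVneq t a; first by right; left.
    have [->|tb'] := eqVneq t b; first by right; right.
    left; apply: badN0 => /= Ht; apply: H; apply: Ht.
    by rewrite !lt_neqAle at_ tb tb' eq_sym ta.
  by exists (derive1 f t) => //; rewrite derive1E; exact: derivableP.
apply/ler_addgt0Pl => e e0.
pose e' := e / (b - a + 1).
have ba0 : 0 < b - a + 1 by rewrite ltr_wpDl// subr_ge0.
have e'0 : 0 < e' by rewrite divr_gt0.
have [dl dl0 H] := fab _ e'0.
have [U [oU NU UNdl]] := @lebesgue_regularity_outer R N dl mN
  (eq_ind_r (fun z => (z < +oo)%E) (ltry 0) N_0) dl0.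
have mU : measurable U by exact: open_measurable.
have Udl : (mu U < dl%:E)%E.
  rewrite -(setDUK NU); apply: le_lt_trans UNdl.
  rewrite -[leRHS]add0e -N_0; apply: measureU2 => //; exact: measurableD.
pose F (s : seq (R * R)) x :=
  [/\ all (fun p => (a <= p.1 <= p.2) && (p.2 <= x)) s,
      pairwise (fun p q => q.2 <= p.1) s,
      ((\sum_(p <- s) (p.2 - p.1))%:E <= mu (U `&` `[a, x[))%E &
      - (e' * (x - a)) - \sum_(p <- s) `|f p.2 - f p.1| <= f x - f a].
have mUx x : measurable (U `&` `[a, x[) by exact: measurableI.
(* [s] lists the cells tagged in the null set, the latest first; comparing
   their total length with the measure of the part of [U] before [x] makes the
   bound additive along the induction *)
have [s [sab spw sU fs]] : exists s, F s b.
  apply: (@gauge_induction a b (fun x => exists s, F s x)) => //.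
    exists [::]; split => //; first by rewrite big_nil measure_ge0.
    by rewrite big_nil !subrr mulr0 oppr0 addr0.
  move=> c acb.
  have [Nc|Nc] := pselect (N c).
    have /nbhs_ballP[rho/= rho0 rhoU] : nbhs c U by apply: open_nbhs_nbhs; split => //; exact: NU.
    exists rho => // x y /andP[ax xc] /andP[cy yb] cx cy' [s [sx spw sU fs]].
    have xy : x <= y by exact: le_trans cy.
    exists ((x, y) :: s); split.
    - rewrite /= ax xy lexx/=; apply: sub_all sx => p /andP[-> px] /=.
      exact: le_trans xy.
    - rewrite /= spw andbT; apply: sub_all sx => p /andP[_ px] //=.
    - rewrite big_cons/=.
      have -> : U `&` `[a, y[ = (U `&` `[a, x[) `|` `[x, y[%classic.
        apply/seteqP; split => z/=; rewrite !in_itv/=.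
          move=> [Uz /andP[az zy]]; case: (ltP z x) => zx; [left|right] => //.
          by rewrite az.
        move=> [[Uz /andP[-> zx]]|/andP[xz zy]].
          by rewrite (lt_le_trans zx).
        rewrite zy (le_trans ax xz); split=> //; apply: rhoU.
        rewrite /ball/= ltr_distlC; apply/andP; split.
          exact: lt_le_trans xz.
        exact: lt_trans zy _.
      rewrite /mu measureU//=; [|exact: mUx|]; last first.
        apply/seteqP; split => z //= [[_]]; rewrite !in_itv/= => /andP[_ zx] /andP[xz _].
        by move: (lt_le_trans zx xz); rewrite ltxx.
      rewrite addrC EFinD leeD// lebesgue_measure_itv/= lte_fin.
      by case: ltP => // yx; rewrite lee_fin subr_le0.
    - rewrite big_cons/=.
      have : - (f y - f x) <= `|f y - f x| by rewrite -normrN ler_norm.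
      have : 0 <= e' * (y - x) by rewrite mulr_ge0// ?subr_ge0// ltW.
      by move: fs; set S := \sum_(_ <- _) _; lra.
  have [df fdf df0] := good c acb Nc.
  have [rho rho0 Hr] := is_derive_near fdf e'0.
  exists rho => // x y /andP[ax xc] /andP[cy yb] cx cy' [s [sx spw sU fs]].
  have xy : x <= y by exact: le_trans cy.
  exists s; split => //.
  - by apply: sub_all sx => p /andP[-> px] /=; exact: le_trans xy.
  - apply: le_trans sU _; apply: le_measure; rewrite ?inE; [exact: mUx|exact: mUx|].
    by move=> z/= [Uz]; rewrite !in_itv/= => /andP[-> zx]; rewrite (lt_le_trans zx).
  - have := Hr y; rewrite ger0_norm ?subr_ge0// => /(_ _)/wrap[]; first lra.
    have := Hr x; rewrite ler0_norm ?subr_le0// => /(_ _)/wrap[]; first lra.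
    rewrite !ler_norml => /andP[_ Hx] /andP[Hy _].
    have : 0 <= df * (y - c) by rewrite mulr_ge0// subr_ge0.
    have : 0 <= df * (c - x) by rewrite mulr_ge0// subr_ge0.
    by move: fs Hx Hy; set S := \sum_(_ <- _) _; lra.
have /= := H (size s) (fun i => (nth (0, 0) s i).1) (fun i => (nth (0, 0) s i).2).
have sE (G : R * R -> R) : \sum_(i < size s) G (nth (0, 0) s i) = \sum_(p <- s) G p.
  by rewrite (big_nth (0, 0)) big_mkord.
rewrite (sE (fun p => p.2 - p.1)) (sE (fun p => `|f p.2 - f p.1|)) => {}H.
have {}H : \sum_(p <- s) `|f p.2 - f p.1| < e'.
  apply: H.
  - move=> i; have := all_nthP (0, 0) sab i (ltn_ord i).
    by move=> /andP[/andP[? ?] ?].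
  - apply/trivIsetP => i j _ _ ij.
    wlog ij' : i j ij / (i < j)%N.
      move=> W; case: (ltngtP i j) => ij'.
      - exact: W.
      - by rewrite setIC; apply: W => //; rewrite eq_sym.
      - by move: ij; rewrite (val_inj ij') eqxx.
    have := pairwiseP (0, 0) spw i j; rewrite !inE => /(_ (ltn_ord i) (ltn_ord j) ij') ji.
    apply/seteqP; split => z //=; rewrite !in_itv/= => -[/andP[iz _] /andP[_ zj]].
    by move: (lt_trans iz zj); rewrite ltNge ji.
  - rewrite -lte_fin (le_lt_trans sU)// (le_lt_trans _ Udl)//.
    by apply: le_measure; rewrite ?inE; [exact: mUx|exact: mU|exact: subIsetl].
have : e' * (b - a + 1) = e by rewrite mulfVK// gt_eqF.
by move: H fs; set S := \sum_(_ <- _) _; lra.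
Qed.

Lemma ae_impl (P Q : R -> Prop) : (forall t, P t -> Q t) ->
  (\forall t \ae lebesgue_measure, P t) -> \forall t \ae lebesgue_measure, Q t.
Proof.
move=> PQ; apply: filterS PQ; exact: (ae_filter_ringOfSetsType lebesgue_measure).
Qed.

Lemma derivable_is_derive1 f t : derivable f t 1 -> is_derive t 1 f (derive1 f t).
Proof. by rewrite derive1E; exact: derivableP. Qed.

Lemma is_derive_derive1 f t df : is_derive t 1 f df ->
  derivable f t 1 /\ derive1 f t = df.
Proof. by move=> fdf; split => //; rewrite derive1E derive_val. Qed.

Lemma is_deriveB1 f g t df dg : is_derive t 1 f df -> is_derive t 1 g dg ->
  is_derive t 1 (fun s => f s - g s) (df - dg).
Proof. by move=> fdf gdg; apply: is_deriveB. Qed.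

Lemma is_derive_linear k t : is_derive t 1 (fun s : R => k * s) k.
Proof. by apply: is_derive_eq; rewrite /GRing.scale/= mulr1. Qed.

Lemma abs_cont_ge a b k f : a <= b -> abs_cont a b f ->
  (\forall t \ae lebesgue_measure, a < t < b ->
     derivable f t 1 /\ k <= derive1 f t) ->
  k * (b - a) <= f b - f a.
Proof.
move=> ab fab fk.
suff : f a - k * a <= f b - k * b by lra.
apply: (@abs_cont_ndecr a b (fun t => f t - k * t)) => //.
  apply: abs_contB => //; apply: (@lipschitz_abs_cont _ _ `|k|) => x y _ xy _.
  by rewrite -mulrBr normrM (ger0_norm (_ : 0 <= y - x))// subr_ge0.
apply: ae_impl fk => t H /H[/derivable_is_derive1 ft kf].
have [? ->] := is_derive_derive1 (is_deriveB1 ft (is_derive_linear k t)).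
by split => //; rewrite subr_ge0.
Qed.

Lemma abs_cont_last_nonneg s t f : s <= t -> abs_cont s t f -> 0 <= f s ->
  f t < 0 ->
  exists sg, [/\ s <= sg, sg < t, 0 <= f sg & forall r, sg < r <= t -> f r < 0].
Proof.
move=> st fst fs ft.
pose S := [set r | s <= r <= t /\ 0 <= f r].
have Ss : S s by split; rewrite ?lexx.
have hS : has_sup S by split; [exists s|exists t => r [/andP[]]].
have s_sup : s <= sup S by exact: sup_upper_bound.
have sup_t : sup S <= t by apply: ge_sup; [exists s|move=> r [/andP[]]].
have fsup : 0 <= f (sup S).
  rewrite leNgt; apply/negP => fneg.
  have fneg' : 0 < - f (sup S) by rewrite oppr_gt0.
  have [dl dl0 H] := abs_cont_modulus fst fneg'.
  have [r [/andP[sr rt] fr] supr] := sup_adherent dl0 hS.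
  have rsup : r <= sup S by apply: sup_upper_bound => //; split => //; rewrite sr.
  have := H r (sup S) sr rsup sup_t; rewrite ltrBlDr -ltrBlDl => /(_ supr).
  by rewrite ltr_norml => /andP[+ _]; lra.
exists (sup S); split => //.
  by rewrite lt_neqAle sup_t andbT; apply: contraTneq ft => <-; rewrite -leNgt.
move=> r /andP[sr rt]; rewrite ltNge; apply/negP => fr.
have : r <= sup S.
  by apply: sup_upper_bound => //; split => //; rewrite rt andbT ltW// (le_lt_trans s_sup).
by rewrite leNgt sr.
Qed.

(** This closes the arguments that improve a bound [M] to [M / 2]: iterated from
    an initial bound [B], they give the hypothesis. *)
Lemma le0_halving (u B : R) : (forall n, u <= B / 2 ^+ n) -> u <= 0.
Proof.
move=> H; rewrite leNgt; apply/negP => u0.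
have B0 : 0 <= B by have := H 0%N; rewrite expr0 divr1; lra.
have /archi_boundP Bn : 0 <= B / u by rewrite divr_ge0// ltW.
set n := Num.Def.archi_bound (B / u) in Bn.
have := H n; rewrite ler_pdivlMr ?exprn_gt0// leNgt => /negP; apply.
move: Bn; rewrite ltr_pdivrMr// => /lt_trans; apply.
rewrite mulrC ltr_pM2l//.
by rewrite -natrX ltr_nat ltn_expl.
Qed.

(** If [f t0 = 0], then [f t <= (`|C| + 1) (t0 - t) sup f] for [t < t0], which
    forces [f = 0] on [[s, t0]] as soon as [(`|C| + 1) (t0 - s) <= 1 / 2]; the
    strict differential inequality cannot hold at any time in [(s, t0)]. *)
Lemma abs_cont_gt0 t0 B C f : 0 < t0 -> abs_cont 0 t0 f ->
  (forall t, 0 <= t <= t0 -> 0 <= f t <= B) ->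
  (\forall t \ae lebesgue_measure, 0 < t < t0 ->
     derivable f t 1 /\ exists2 c, `|c| <= C & c * f t < derive1 f t) ->
  0 < f t0.
Proof.
move=> t00 fac fB fder.
have /andP[ft0 _] : 0 <= f t0 <= B by apply: fB; rewrite lexx ltW.
rewrite lt_neqAle ft0 andbT; apply/eqP => /esym f0.
have C0 : 0 < `|C| + 1 by rewrite ltr_wpDl.
pose s := Num.max 0 (t0 - ((`|C| + 1) * 2)^-1).
have s0 : 0 <= s by rewrite /s le_max lexx.
have st0 : s < t0 by rewrite /s gt_max t00 gtrBl invr_gt0 mulr_gt0.
have Cs : (`|C| + 1) * (t0 - s) <= 2^-1.
  have : t0 - s <= ((`|C| + 1) * 2)^-1 by rewrite lerBlDr -lerBlDl /s le_max lexx orbT.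
  by rewrite invfM -ler_pdivlMl.
have halve M : (forall t, s <= t <= t0 -> f t <= M) ->
    forall t, s <= t <= t0 -> f t <= M / 2.
  move=> fM t /andP[st tt0].
  have M0 : 0 <= M by rewrite -f0 fM// lexx ltW.
  have := @abs_cont_ge t t0 (- ((`|C| + 1) * M)) f tt0.
  rewrite f0 => /(_ _ _)/wrap[].
    by apply: abs_cont_sub fac => //; exact: le_trans st.
  apply: ae_impl fder => r H /andP[tr rt0].
  have [|fd [c cC cf]] := H; first by rewrite (le_lt_trans (le_trans s0 st) tr).
  split => //; apply/ltW/(le_lt_trans _ cf).
  have /andP[fr0 _] : 0 <= f r <= B by apply: fB; lra.
  have frM : f r <= M by apply: fM; lra.
  have : `|c * f r| <= (`|C| + 1) * M.
    rewrite normrM ler_pM//; first by have := ler_norm C; lra.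
    by rewrite ger0_norm.
  by rewrite ler_norml => /andP[].
move=> Hge.
have : (`|C| + 1) * (t0 - t) * M <= 2^-1 * M.
  rewrite ler_wpM2r// (le_trans _ Cs)// ler_wpM2l// ?(ltW C0)//; lra.
by move: Hge; lra.
have fz t : s <= t <= t0 -> f t = 0.
  move=> stt0; apply/eqP; rewrite eq_le; apply/andP; split; last first.
    by have /andP[] : 0 <= f t <= B by apply: fB; lra.
  apply: (@le0_halving _ B) => n; move: t stt0; elim: n => [|n IH] t tt.
    by rewrite expr0 divr1; have /andP[] : 0 <= f t <= B by apply: fB; lra.
  by rewrite exprSr invfM mulrA; exact: halve.
(* no time in [(s, t0)] is admissible, so any derivative bound holds there
   almost everywhere: take the absurd bound [1] for [t |-> - t] *)
have := @abs_cont_ge s t0 1 (fun t => - t) (ltW st0).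
move=> /(_ _ _)/wrap[].
  apply: (@lipschitz_abs_cont _ _ 1) => x y _ xy _.
  by rewrite mul1r -opprD normrN ger0_norm// subr_ge0.
apply: ae_impl fder => t H /andP[st tt0]; exfalso.
have [|fd [c cC cf]] := H; first by lra.
rewrite fz ?mulr0 in cf; last by lra.
have e0 : 0 < derive1 f t / 2 by rewrite divr_gt0.
have [rho rho0 Hr] := is_derive_near (derivable_is_derive1 fd) e0.
pose h := Num.min (rho / 2) (t0 - t).
have h0 : 0 < h by rewrite /h lt_min; apply/andP; split; lra.
have hr : h <= rho / 2 by rewrite /h ge_min lexx.
have ht : h <= t0 - t by rewrite /h ge_min lexx orbT.
have := Hr (t + h); rewrite addrAC subrr add0r (gtr0_norm h0) => /(_ _)/wrap[]; first lra.
rewrite !fz; [|lra|lra].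
rewrite subrr sub0r normrN gtr0_norm ?mulr_gt0//.
have := mulr_gt0 cf h0; lra.
lra.
Qed.

End AbsoluteContinuity.

(** * The linear comparison principle *)

Section Comparison.
Set Implicit Arguments.
Unset Strict Implicit.
Context {R : realType} {X : pzRingType}.

(** The coefficient [c] is chosen at each [(x, t)] separately, so that it can be
    a difference quotient of a nonlinearity.  The gauge [(K * 4)^-1] bounds the
    cell on each side of its tag, which makes [K (y - s) <= 1 / 2]. *)
Lemma linear_comparison (b B C : R) (w : X -> R -> R) :
  (forall x, abs_cont 0 b (w x)) ->
  (forall x t, 0 <= t <= b -> - B <= w x t) ->
  (forall x, 0 <= w x 0) ->
  (forall x, \forall t \ae lebesgue_measure, 0 < t < b ->
     derivable (w x) t 1 /\
     exists2 c, `|c| <= C & w (x + 1) t + w (x - 1) t + c * w x t <= derive1 (w x) t) ->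
  forall x t, 0 <= t <= b -> 0 <= w x t.
Proof.
move=> wac wB w0 wder x0 t0 /andP[t00 t0b].
have b0 : 0 <= b by exact: le_trans t0b.
pose K := 2 + `|C|.
have K0 : 0 < K by rewrite ltr_wpDr.
suff : forall x t, 0 <= t <= b -> 0 <= w x t by apply; rewrite t00.
clear x0 t0 t00 t0b.
apply: (@gauge_induction R 0 b (fun tau => forall x t, 0 <= t <= tau -> 0 <= w x t)) => //.
  by move=> x t; rewrite -eq_le => /eqP <-.
move=> c c0b; exists (K * 4)^-1; first by rewrite invr_gt0 mulr_gt0.
move=> s y /andP[s0 sc] /andP[cy yb] cs yc Ps.
have sy : s <= y by exact: le_trans cy.
have Ksy : K * (y - s) <= 2^-1.
  have ys : y - s <= 2 * (K * 4)^-1 by lra.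
  have -> : 2^-1 = K * (2 * (K * 4)^-1) :> R by field; rewrite gt_eqF.
  by rewrite ler_pM2l.
have halve M : 0 <= M -> (forall x t, 0 <= t <= y -> - M <= w x t) ->
    forall x t, 0 <= t <= y -> - (M / 2) <= w x t.
  move=> M0 wM x t /andP[t0 ty].
  have M20 : - (M / 2) <= 0 by rewrite oppr_le0 divr_ge0.
  have [ts|st] := leP t s; first by rewrite (le_trans M20)// Ps// t0.
  have [wt|wt] := leP 0 (w x t); first exact: le_trans wt.
  have tb : t <= b by exact: le_trans yb.
  have ws : 0 <= w x s by apply: Ps; rewrite s0 lexx.
  (* on [(sg, t]] the term [c w] is at least [- `|C| M] because [- M <= w < 0],
     whereas no upper bound for [w] of order [M] is available in general *)
  have [sg [ssg sgt wsg wneg]] :=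
    abs_cont_last_nonneg (ltW st) (abs_cont_sub s0 tb (wac x)) ws wt.
  have sg0 : 0 <= sg by exact: le_trans ssg.
  have := @abs_cont_ge _ sg t (- (K * M)) (w x) (ltW sgt) (abs_cont_sub sg0 tb (wac x)).
  move=> /(_ _)/wrap[].
    apply: ae_impl (wder x) => r H /andP[sgr rt].
    have [|wd [cf cC wr]] := H; first by lra.
    split => //; apply: le_trans wr.
    have rty : 0 <= r <= y by lra.
    have wr0 : w x r < 0 by apply: wneg; lra.
    have := wM x _ rty; have := wM (x + 1) _ rty; have := wM (x - 1) _ rty.
    move=> w1 w2 w3.
    have : `|cf * w x r| <= `|C| * M.
      rewrite normrM ler_pM//; last by rewrite ltr0_norm//; lra.
      by rewrite (le_trans cC)// ler_norm.
    by rewrite ler_norml /K => /andP[]; lra.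
  have : K * (t - sg) * M <= 2^-1 * M.
    rewrite ler_wpM2r// (le_trans _ Ksy)// ler_wpM2l// ?(ltW K0)//; lra.
  lra.
move=> x t t0y; rewrite -oppr_le0; apply: (@le0_halving _ _ `|B|) => n.
rewrite lerNl; move: x t t0y; elim: n => [|n IH] x t /andP[t0 ty].
  rewrite expr0 divr1; apply: le_trans (wB x t _); last by rewrite t0 (le_trans ty).
  by rewrite lerN2 ler_norm.
rewrite exprSr invfM mulrA; apply: halve; rewrite ?t0//.
Qed.

End Comparison.

(** * Primitives and geometric convergence *)

Section Calculus.
Set Implicit Arguments.
Unset Strict Implicit.
Context {R : realType}.
Implicit Types (f g : R -> R) (a b t : R).

Lemma derive_bound f g (df dg : R -> R) a b : a <= b ->
  (forall t, a <= t <= b -> [/\ is_derive t 1 f (df t),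
     is_derive t 1 g (dg t) & `|df t| <= dg t]) ->
  `|f b - f a| <= g b - g a.
Proof.
move=> ab H.
have mono (h dh : R -> R) : (forall t, a <= t <= b -> is_derive t 1 h (dh t) /\ 0 <= dh t) ->
    h a <= h b.
  move=> hdh.
  have [x| |c cab hE] := @MVT_segment R h dh a b ab.
  - by rewrite in_itv/= => /andP[ax xb]; apply: (hdh x _).1; rewrite !ltW.
  - apply: derivable_within_continuous => x; rewrite in_itv/= => /hdh[hx _].
    exact: ex_derive.
  - rewrite -subr_ge0 hE mulr_ge0// ?subr_ge0//.
    by apply: (hdh c _).2; rewrite in_itv/= in cab.
have := @mono (fun t => g t - f t) (fun t => dg t - df t) _.
have := @mono (fun t => g t + f t) (fun t => dg t + df t) _.
move=> /(_ _)/wrap[].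
  move=> t /H[fd gd]; rewrite ler_norml => /andP[? ?].
  by split; [exact: is_deriveD|lra].
move=> H1 /(_ _)/wrap[].
  move=> t /H[fd gd]; rewrite ler_norml => /andP[? ?].
  by split; [exact: is_deriveB|lra].
by move=> H2; rewrite ler_norml; apply/andP; split; lra.
Qed.

(** Integrating from [-1] makes the derivative two-sided at [0]. *)
Definition primitive f t : R :=
  \int[lebesgue_measure]_(s in `[-1, t]) f s -
  \int[lebesgue_measure]_(s in `[-1, 0]) f s.

Lemma primitive0 f : primitive f 0 = 0.
Proof. exact: subrr. Qed.

Lemma is_derive_primitive f t : continuous f -> 0 <= t ->
  is_derive t 1 (primitive f) (f t).
Proof.
move=> cf t0.
have [||||dF FE] := @continuous_FTC1 R f (BLeft (-1)) t (t + 1) _.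
- by rewrite ltrDl.
- apply: continuous_compact_integrable; first exact: segment_compact.
  exact: continuous_subspaceT.
- by rewrite lte_fin (lt_le_trans _ t0)// ltrN10.
- exact: cf.
have dF' := derivable_is_derive1 dF.
rewrite FE in dF'.
have := is_deriveB1 dF' (is_derive_cst (\int[lebesgue_measure]_(s in `[-1, 0]) f s) t 1).
by rewrite subr0.
Qed.

Lemma is_derive_cexpR (K c t : R) :
  is_derive t 1 (fun s => K * expR (c * s)) (K * (expR (c * t) * c)).
Proof.
have h := is_derive1_comp (is_derive_expR (c * t)) (is_derive_linear c t).
exact: (@is_deriveZ _ _ _ _ _ _ _ _ h).
Qed.

Lemma continuous_bounded f a b : continuous f -> exists B, forall t, a <= t <= b -> `|f t| <= B.
Proof.
move=> cf; have [ab|ba] := leP a b; last first.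
  by exists 0 => t /andP[at_ tb]; move: (le_trans at_ tb); rewrite leNgt ba.
have [|c cab cmax] := @EVT_max R (fun t => `|f t|) a b ab.
  by apply: continuous_subspaceT => t; apply: cvg_norm; exact: cf.
by exists `|f c| => t tab; apply: cmax; rewrite in_itv.
Qed.

Lemma geometric_cvg (s : nat -> R) l E :
  (forall n, `|s n - l| <= E / 2 ^+ n) -> s @ \oo --> l.
Proof.
move=> sl.
have e0 : E / 2 ^+ n @[n --> \oo] --> (0 : R).
  rewrite -(mulr0 E); apply: cvgM; first exact: cvg_cst.
  under eq_fun do rewrite -exprVn.
  by apply: cvg_expr; rewrite ger0_norm ?invf_lt1// ltr1n.
apply/cvgrPdist_lt => e eps0; near=> n.
rewrite distrC (le_lt_trans (sl n))// (le_lt_trans (ler_norm _))//.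
by rewrite -normrN -sub0r; near: n; exact: cvgr_dist_lt e0 _ eps0.
Unshelve. all: by end_near. Qed.

Lemma geometric_lim (s : nat -> R) E :
  (forall n, `|s n.+1 - s n| <= E / 2 ^+ n) ->
  forall n, `|s n - lim (s @ \oo)| <= 2 * E / 2 ^+ n.
Proof.
move=> sE.
have E0 : 0 <= E by have := sE 0%N; rewrite expr0 divr1; exact: le_trans.
pose q n : R := 2 * E / 2 ^+ n.
have qS n : q n = q n.+1 + E / 2 ^+ n by rewrite /q exprS; field; rewrite expf_neq0.
have q0 n : 0 <= q n by rewrite /q divr_ge0 ?mulr_ge0// exprn_ge0.
have dist n m : `|s (m + n)%N - s n| <= q n - q (m + n)%N.
  elim: m => [|m IH]; first by rewrite !subrr normr0.
  have := sE (m + n)%N; have := qS (m + n)%N; rewrite addSn.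
  have := ler_distD (s (m + n)%N) (s (m + n).+1) (s n); lra.
have aub n m : s n - q n <= s m + q m.
  have [nm|mn] := leqP n m.
    have := dist n (m - n)%N; rewrite subnK// ler_norml => /andP[].
    have := q0 m; lra.
  have := dist m (n - m)%N; rewrite subnK ?(ltnW mn)// ler_norml => /andP[_].
  have := q0 n; lra.
pose l := sup (range (fun n => s n - q n)).
have sl n : `|s n - l| <= q n.
  have l1 : s n - q n <= l.
    by apply: ub_le_sup; [exists (s n + q n) => _ [m _ <-]|exists n].
  have l2 : l <= s n + q n by apply: ge_sup; [exists (s n - q n), n|move=> _ [m _ <-]].
  by rewrite ler_norml; apply/andP; split; lra.
by rewrite (cvg_lim _ (geometric_cvg sl)).
Qed.

End Calculus.

(** * Picard iteration for a globally Lipschitz reaction term *)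

Section Picard.
Set Implicit Arguments.
Unset Strict Implicit.
Context {R : realType} {X : pzRingType}.
Variables (A psi : R -> R) (k B0 : R) (u0 : X -> R).
Hypothesis A_cont : continuous A.
Hypothesis psi_lip : forall r s, `|psi r - psi s| <= k * `|r - s|.
Hypothesis u0_bounded : forall x, `|u0 x| <= B0.
Implicit Types (v : X -> R -> R) (t : R).

Definition field v x t : R := Hop (v ^~ t) x + A t * psi (v x t).

(** Freezing a function at negative times makes the integrands continuous on the
    whole line while only nonnegative times are controlled. *)
Definition freeze v x t : R := v x (Num.max t 0).

Definition picard_step v x t : R := u0 x + primitive (field (freeze v) x) t.

Definition time_continuous v := forall x, continuous (freeze v x).

Let k_ge0 : 0 <= k.
Proof. by have := psi_lip 1 0; rewrite subr0 normr1 mulr1; exact: le_trans. Qed.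

Lemma field_freeze v x t : 0 <= t -> field (freeze v) x t = field v x t.
Proof. by move=> t0; rewrite /field /freeze /Hop (max_idPl t0). Qed.

Lemma field_bound v x t D Ab : `|A t| <= Ab -> (forall y, `|v y t| <= D) ->
  `|field v x t| <= 4 * D + Ab * (`|psi 0| + k * D).
Proof.
move=> AAb vD; rewrite /field /Hop.
have := ler_normD (v (x + 1) t + v (x - 1) t - 2 * v x t) (A t * psi (v x t)).
have := ler_normB (v (x + 1) t + v (x - 1) t) (2 * v x t).
have := ler_normD (v (x + 1) t) (v (x - 1) t).
have := vD x; have := vD (x + 1); have := vD (x - 1).
rewrite normrM (ger0_norm (_ : 0 <= 2))//.
have : `|A t * psi (v x t)| <= Ab * (`|psi 0| + k * D).
  rewrite normrM ler_pM//.
  have := psi_lip (v x t) 0; rewrite subr0.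
  have := ler_normD (psi (v x t) - psi 0) (psi 0); rewrite subrK.
  have : k * `|v x t| <= k * D by rewrite ler_wpM2l.
  lra.
lra.
Qed.

Lemma field_lip v v' x t D Ab : `|A t| <= Ab ->
  (forall y, `|v y t - v' y t| <= D) ->
  `|field v x t - field v' x t| <= (4 + Ab * k) * D.
Proof.
move=> AAb vD; rewrite /field /Hop.
have -> : v (x + 1) t + v (x - 1) t - 2 * v x t + A t * psi (v x t) -
  (v' (x + 1) t + v' (x - 1) t - 2 * v' x t + A t * psi (v' x t)) =
  (v (x + 1) t - v' (x + 1) t) + (v (x - 1) t - v' (x - 1) t)
  - 2 * (v x t - v' x t) + A t * (psi (v x t) - psi (v' x t)) by ring.
set d1 := v (x + 1) t - _; set d2 := v (x - 1) t - _; set d3 := v x t - v' x t.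
have := ler_normD (d1 + d2 - 2 * d3) (A t * (psi (v x t) - psi (v' x t))).
have := ler_normB (d1 + d2) (2 * d3).
have := ler_normD d1 d2.
have := vD x; have := vD (x + 1); have := vD (x - 1).
rewrite normrM (ger0_norm (_ : 0 <= 2))//.
have : `|A t * (psi (v x t) - psi (v' x t))| <= Ab * (k * D).
  rewrite normrM ler_pM// (le_trans (psi_lip _ _))// ler_wpM2l//.
rewrite -/d1 -/d2 -/d3; lra.
Qed.

Lemma freeze_field_continuous v x : time_continuous v -> continuous (field (freeze v) x).
Proof.
move=> vc t; apply: cvgD; last first.
  apply: cvgM; first exact: A_cont.
  have psic : continuous psi.
    move=> r; apply/cvgrPdist_lt => e e0.
    have k1 : 0 < k + 1 by rewrite ltr_wpDl.
    have ek : 0 < e / (k + 1) by rewrite divr_gt0.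
    near=> s.
    rewrite (le_lt_trans (psi_lip _ _))//.
    apply: (@le_lt_trans _ _ ((k + 1) * `|r - s|)); first by rewrite ler_wpM2r// lerDl.
    rewrite mulrC -ltr_pdivlMr//; near: s; exact: (cvgr_dist_lt cvg_id).
  by apply: continuous_comp; [exact: vc|exact: psic].
apply: cvgB; last by apply: cvgM; [exact: cvg_cst|exact: vc].
by apply: cvgD; exact: vc.
Unshelve. all: by end_near. Qed.

Lemma picard_step_derive v x t : time_continuous v -> 0 <= t ->
  is_derive t 1 (picard_step v x) (field v x t).
Proof.
move=> vc t0; rewrite -field_freeze//.
have := is_derive_primitive (@freeze_field_continuous v x vc) t0.
move=> /(@is_deriveD _ _ _ _ _ _ _ _ _ (is_derive_cst (u0 x) t 1)).
by rewrite add0r.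
Qed.

Lemma freeze_continuous v : (forall x t, 0 <= t -> {for t, continuous (v x)}) ->
  time_continuous v.
Proof.
move=> vc x t; rewrite /freeze.
apply: (@continuous_comp _ _ _ (fun t : R => Num.max t 0) (v x)).
  by apply: (@continuous_max R R id (fun=> 0)); [exact: cvg_id|exact: cvg_cst].
by apply: vc; rewrite le_max lexx orbT.
Qed.

Lemma picard_step_continuous v : time_continuous v -> time_continuous (picard_step v).
Proof.
move=> vc; apply: freeze_continuous => x t t0.
have [d _] := picard_step_derive x vc t0.
exact/differentiable_continuous/derivable1_diffP.
Qed.

Definition picard n := iter n picard_step (fun x _ => u0 x).

Lemma picard_continuous n : time_continuous (picard n).
Proof.
elim: n => [|n IH] /=; last exact: picard_step_continuous.
by move=> x t; exact: cvg_cst.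
Qed.

Lemma picard0 n x : picard n x 0 = u0 x.
Proof. by case: n => [|n] //=; rewrite /picard_step primitive0 addr0. Qed.

(** With the weight [expR (2 * L * t)], [L] being the Lipschitz constant of the
    field on [[0, b]], integrating in time gains a factor [1 / (2 L)] and each
    iteration contracts by [1 / 2], whatever the length [b]. *)
Lemma picard_geometric b : 0 <= b -> exists E, forall n x t, 0 <= t <= b ->
  `|picard n.+1 x t - picard n x t| <= E / 2 ^+ n.
Proof.
move=> b0; have [Ab AAb] := continuous_bounded 0 b A_cont.
have Ab0 : 0 <= Ab by apply: le_trans (AAb 0 _); rewrite ?lexx.
have B00 : 0 <= B0 by exact: le_trans (u0_bounded 0).
pose D0 := 4 * B0 + Ab * (`|psi 0| + k * B0); pose L := 4 + Ab * k.
have D00 : 0 <= D0 by rewrite addr_ge0 ?mulr_ge0// addr_ge0// mulr_ge0.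
have L0 : 0 < L by rewrite ltr_wpDr// mulr_ge0.
pose D := D0 / (2 * L).
have D_0 : 0 <= D by rewrite divr_ge0// mulr_ge0// ltW.
suff H n x t : 0 <= t <= b ->
    `|picard n.+1 x t - picard n x t| <= D / 2 ^+ n * expR (2 * L * t).
  exists (D * expR (2 * L * b)) => n x t /andP[t0 tb].
  rewrite (le_trans (H n x t _)) ?t0//.
  rewrite mulrAC ler_wpM2r ?invr_ge0 ?exprn_ge0// ler_wpM2l// ler_expR ler_wpM2l//.
  by rewrite mulr_ge0// ltW.
elim: n x t => [|n IH] x t /andP[t0 tb].
  have := @derive_bound R (picard 1 x) (fun s => D * expR (2 * L * s))
    (field (picard 0) x) (fun s => D * (expR (2 * L * s) * (2 * L))) 0 t t0.
  move=> /(_ _)/wrap[].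
    move=> s /andP[s0 st]; split.
    - exact: (picard_step_derive x (@picard_continuous 0) s0).
    - exact: is_derive_cexpR.
    - apply: (@le_trans _ _ D0).
        by apply: field_bound; [apply: AAb; rewrite s0 (le_trans st)|exact: u0_bounded].
      have -> : D * (expR (2 * L * s) * (2 * L)) = D0 * expR (2 * L * s).
        by rewrite /D; field; rewrite gt_eqF.
      rewrite ler_peMr// -expR0 ler_expR mulr_ge0// mulr_ge0// ltW//.
  rewrite picard0 mulr0 expR0 expr0 divr1 mulr1 /= => H.
  by apply: le_trans H _; rewrite gerBl.
have := @derive_bound R (fun s => picard n.+2 x s - picard n.+1 x s)
  (fun s => D / 2 ^+ n.+1 * expR (2 * L * s))
  (fun s => field (picard n.+1) x s - field (picard n) x s)
  (fun s => D / 2 ^+ n.+1 * (expR (2 * L * s) * (2 * L))) 0 t t0.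
move=> /(_ _)/wrap[].
  move=> s /andP[s0 st]; split.
  - apply: is_deriveB1.
      exact: (picard_step_derive x (@picard_continuous n.+1) s0).
    exact: (picard_step_derive x (@picard_continuous n) s0).
  - exact: is_derive_cexpR.
  - have -> : D / 2 ^+ n.+1 * (expR (2 * L * s) * (2 * L)) =
        L * (D / 2 ^+ n * expR (2 * L * s)).
      by rewrite exprS; field; rewrite expf_neq0.
    have sb : 0 <= s <= b by rewrite s0 (le_trans st).
    by apply: field_lip; [exact: AAb|move=> y; exact: IH].
rewrite !picard0 mulr0 expR0 mulr1 subrr subr0 => H.
by apply: le_trans H _; rewrite gerBl divr_ge0// exprn_ge0.
Qed.

Definition picard_limit x t := lim (picard n x t @[n --> \oo]).

Lemma picard_limitP b : 0 <= b -> exists E, forall n x t, 0 <= t <= b ->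
  `|picard n x t - picard_limit x t| <= E / 2 ^+ n.
Proof.
move=> b0; have [E HE] := picard_geometric b0; exists (2 * E) => n x t tb.
exact: (@geometric_lim R (fun m => picard m x t) E (fun m => HE m x t tb) n).
Qed.

Lemma picard_limit_continuous : time_continuous picard_limit.
Proof.
move=> x t; apply/cvgrPdist_lt => e e0.
pose b := Num.max t 0 + 1.
have b0 : 0 <= b by rewrite addr_ge0// le_max lexx orbT.
have [E HE] := picard_limitP b0.
have [n En] : exists n, E / 2 ^+ n < e / 3.
  apply: contrapT => H.
  have : e / 3 <= 0.
    apply: (@le0_halving _ _ E) => n; rewrite leNgt; apply/negP => En.
    by apply: H; exists n.
  lra.
have e3 : 0 < e / 3 by lra.
near=> s.
have st : Num.max s 0 <= b.
  rewrite /b ge_max b0 andbT.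
  have : `|t - s| < 1 by near: s; exact: (@nbhsx_ballx _ _ t 1).
  rewrite ltr_norml => /andP[+ _].
  have : t <= Num.max t 0 by rewrite le_max lexx.
  lra.
have sb : 0 <= Num.max s 0 <= b by rewrite st le_max lexx orbT.
have tb : 0 <= Num.max t 0 <= b by rewrite le_max lexx orbT lerDl ler01.
have := HE n x _ sb; have := HE n x _ tb.
have : `|freeze (picard n) x t - freeze (picard n) x s| < e / 3.
  near: s; by move/cvgrPdist_lt: (@picard_continuous n x t); apply.
rewrite /freeze !ltr_norml !ler_norml => /andP[? ?] /andP[? ?] /andP[? ?].
by apply/andP; split; lra.
Unshelve. all: by end_near. Qed.

(** The limit of the iterates is a fixed point of [picard_step] at nonnegative
    times only; its image under [picard_step] agrees with it there and is
    moreover differentiable on both sides at time [0]. *)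
Theorem picard_solution : exists U : X -> R -> R,
  [/\ forall x, U x 0 = u0 x,
      forall x t, 0 <= t -> is_derive t 1 (U x) (field U x t) &
      forall b, exists B, forall x t, 0 <= t <= b -> `|U x t| <= B].
Proof.
pose U := picard_step picard_limit.
have VU x t : 0 <= t -> picard_limit x t = U x t.
  move=> t0; have [E HE] := picard_limitP t0.
  have [Ab AAb] := continuous_bounded 0 t A_cont.
  have H n : `|picard n.+1 x t - U x t| <= (4 + Ab * k) * E * t / 2 ^+ n.
    have := @derive_bound R (fun s => picard n.+1 x s - U x s)
      (fun s => (4 + Ab * k) * (E / 2 ^+ n) * s)
      (fun s => field (picard n) x s - field picard_limit x s)
      (fun=> (4 + Ab * k) * (E / 2 ^+ n)) 0 t t0.
    move=> /(_ _)/wrap[].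
      move=> s st; have /andP[s0 _] := st; split.
      - apply: is_deriveB1; first exact: (picard_step_derive x (@picard_continuous n) s0).
        exact: (picard_step_derive x picard_limit_continuous s0).
      - exact: is_derive_linear.
      - by apply: field_lip; [exact: AAb|move=> y; exact: HE].
    rewrite picard0 {2}/U /picard_step primitive0 addr0 mulr0 !subr0 subrr subr0.
    by move=> /le_trans; apply; rewrite le_eqVlt; apply/orP; left; apply/eqP; ring.
  apply/eqP; rewrite -subr_eq0 -normr_le0.
  apply: (@le0_halving _ _ (E + (4 + Ab * k) * E * t)) => n.
  have := HE n.+1 x t; rewrite t0 lexx distrC => /(_ isT).
  have := H n; have := ler_distD (picard n.+1 x t) (picard_limit x t) (U x t).
  have : E / 2 ^+ n.+1 <= E / 2 ^+ n.
    have E0 : 0 <= E.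
      have := HE 0%N x t; rewrite t0 lexx expr0 divr1 => /(_ isT); exact: le_trans.
    by rewrite ler_wpM2l// lef_pV2 ?posrE ?exprn_gt0// exprS ler_peMl ?exprn_ge0// ler1n.
  by rewrite mulrDl; lra.
exists U; split.
- by move=> x; rewrite /U /picard_step primitive0 addr0.
- move=> x t t0; have := picard_step_derive x picard_limit_continuous t0.
  by rewrite -[picard_step _]/U /field /Hop !VU.
- move=> b; have [b0|b0] := leP 0 b; last first.
    by exists 0 => x t /andP[t0 tb]; move: (le_trans t0 tb); rewrite leNgt b0.
  have [E HE] := picard_limitP b0; exists (B0 + E) => x t tb.
  have /andP[t0 _] := tb; rewrite -VU//.
  have := HE 0%N x t tb; rewrite expr0 divr1 /=.
  have := u0_bounded x; have := ler_distD (u0 x) (picard_limit x t) 0.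
  by rewrite !subr0 distrC; lra.
Qed.

End Picard.

(** * Comparison for the equation *)

Section KPP.
Set Implicit Arguments.
Unset Strict Implicit.
Context {R : realType}.

Lemma locally_hoelder_continuous (f : R -> R) : locally_hoelder f -> continuous f.
Proof.
move=> hf t; have [al [C [al0 al1 [[P Q] [Pt Qt] /= H]]]] := hf t.
have Qtt := nbhs_singleton Qt.
apply/cvgrPdist_lt => e e0.
have C0 : 0 < `|C| + 1 by rewrite ltr_wpDl.
have eC0 : 0 < e / (`|C| + 1) by rewrite divr_gt0.
pose rho := (e / (`|C| + 1)) `^ al^-1.
have rho0 : 0 < rho by rewrite powR_gt0.
near=> s.
have Ps : P s by near: s.
have st : `|t - s| < rho by near: s; exact: (@nbhsx_ballx _ _ t rho).
rewrite distrC (le_lt_trans (H (s, t) (conj Ps Qtt)))//=.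
have : `|s - t| `^ al < e / (`|C| + 1).
  have -> : e / (`|C| + 1) = rho `^ al.
    by rewrite /rho -powRrM mulVf ?powRr1 ?gt_eqF// ltW.
  by rewrite gt0_ltr_powR ?nnegrE ?(ltW rho0)// distrC.
rewrite ltr_pdivlMr// => h; apply: le_lt_trans h.
rewrite mulrC ler_wpM2l ?powR_ge0//.
by rewrite (le_trans (ler_norm C))// lerDl.
Unshelve. all: by end_near. Qed.

Lemma linfP (X : pzRingType) (u : X -> R) : linf u <-> exists B, forall x, `|u x| <= B.
Proof.
split => [[B [_ /(_ (B + 1))]]|[B uB]].
  by rewrite ltrDl ltr01 => /(_ isT) H; exists (B + 1) => x; exact: H.
by exists B; split; [exact: num_real|move=> y By x _; exact: le_trans (ltW By)].
Qed.

Lemma bounded_domP (X : pzRingType) (T : \bar R) (v : X -> R -> R) : bounded_dom T v ->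
  exists B, forall x t, time_dom T t -> `|v x t| <= B.
Proof.
move=> [B [_ /(_ (B + 1))]]; rewrite ltrDl ltr01 => /(_ isT) H.
by exists (B + 1) => x t Tt; exact: (H (x, t)).
Qed.

Lemma linf_norm_le (X : pzRingType) (u : X -> R) e : (forall x, `|u x| <= e) ->
  0 <= linf_norm u <= e.
Proof.
move=> ue; apply/andP; split.
  apply: (@le_trans _ _ `|u 0|) => //.
  by apply: ub_le_sup; [exists e => _ [x _ <-]|exists 0].
by apply: ge_sup; [exists `|u 0|, 0|move=> _ [x _ <-]].
Qed.

Lemma ler_linf_norm (X : pzRingType) (u : X -> R) x : linf u -> `|u x| <= linf_norm u.
Proof.
by move=> /linfP[B uB]; apply: ub_le_sup; [exists B => _ [y _ <-]|exists x].
Qed.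

Lemma time_dom_le (T : \bar R) b t : time_dom T b -> 0 <= t <= b -> time_dom T t.
Proof. by move=> [_ bT] /andP[t0 tb]; split => //; apply: le_lt_trans bT; rewrite lee_fin. Qed.

Variable X : pzRingType.
Implicit Types (u v : X -> R -> R) (A : R -> R).

(** The difference of the two right hand sides is linear in [v - u] with a
    bounded zeroth order coefficient and nonnegative coupling. *)
Lemma kppB a (u v : X -> R) x : kpp a v x - kpp a u x =
  (v (x + 1) - u (x + 1)) + (v (x - 1) - u (x - 1)) +
  (a * (1 - u x - v x) - 2) * (v x - u x).
Proof. by rewrite /kpp /Hop; ring. Qed.

Lemma kpp_coeff_bound a p q Ab B : `|a| <= Ab -> `|p| <= B -> `|q| <= B ->
  `|a * (1 - p - q) - 2| <= Ab * (1 + 2 * B) + 2 :> R.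
Proof.
move=> aA pB qB.
have : `|a * (1 - p - q)| <= Ab * (1 + 2 * B).
  rewrite normrM ler_pM//.
  by move: pB qB; rewrite !ler_norml => /andP[? ?] /andP[? ?]; apply/andP; split; lra.
by rewrite !ler_norml => /andP[? ?]; apply/andP; split; lra.
Qed.

Lemma kpp_bound a (u : X -> R) x Ab B : `|a| <= Ab -> (forall y, `|u y| <= B) ->
  `|kpp a u x| <= 4 * B + Ab * (B * (1 + B)).
Proof.
move=> aA uB.
have : `|a * u x * (1 - u x)| <= Ab * (B * (1 + B)).
  rewrite -mulrA normrM ler_pM// normrM ler_pM//.
  by have := uB x; rewrite !ler_norml => /andP[? ?]; apply/andP; split; lra.
rewrite /kpp /Hop.
have := uB x; have := uB (x + 1); have := uB (x - 1).
rewrite !ler_norml => /andP[? ?] /andP[? ?] /andP[? ?] /andP[? ?].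
by apply/andP; split; lra.
Qed.

Lemma kpp_comparison A b B u v : continuous A ->
  (forall x t, 0 <= t <= b -> `|u x t| <= B /\ `|v x t| <= B) ->
  (forall x, abs_cont 0 b (u x) /\ abs_cont 0 b (v x)) ->
  (forall x, u x 0 <= v x 0) ->
  (forall x, \forall t \ae lebesgue_measure, 0 < t < b ->
     [/\ derivable (u x) t 1, derivable (v x) t 1 &
         derive1 (u x) t - kpp (A t) (u ^~ t) x <=
         derive1 (v x) t - kpp (A t) (v ^~ t) x]) ->
  forall x t, 0 <= t <= b -> u x t <= v x t.
Proof.
move=> cA uvB uvac uv0 uvd x t tb; rewrite -subr_ge0.
have [Ab AAb] := continuous_bounded 0 b cA.
apply: (@linear_comparison R X b (2 * B) (Ab * (1 + 2 * B) + 2)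
  (fun x t => v x t - u x t)) => //.
- by move=> y; apply: abs_contB; [exact: (uvac y).2|exact: (uvac y).1].
- move=> y s /(uvB y)[]; rewrite !ler_norml => /andP[? ?] /andP[? ?]; lra.
- by move=> y; rewrite subr_ge0.
- move=> y; apply: ae_impl (uvd y) => s H s0b.
  have [du dv uv] := H s0b.
  have [dw ->] := is_derive_derive1 (is_deriveB1 (derivable_is_derive1 dv) (derivable_is_derive1 du)).
  have sb : 0 <= s <= b by have /andP[? ?] := s0b; rewrite !ltW.
  split => //; exists (A s * (1 - u y s - v y s) - 2).
    by have [? ?] := uvB y s sb; apply: kpp_coeff_bound => //; exact: AAb.
  by have := kppB (A s) (u ^~ s) (v ^~ s) y; lra.
Qed.

Lemma kpp_strict_comparison A b B u v : continuous A -> 0 < b ->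
  (forall x t, 0 <= t <= b -> `|u x t| <= B /\ `|v x t| <= B) ->
  (forall x, abs_cont 0 b (u x) /\ abs_cont 0 b (v x)) ->
  (forall x, u x 0 <= v x 0) ->
  (forall x, \forall t \ae lebesgue_measure, 0 < t < b ->
     [/\ derivable (u x) t 1, derivable (v x) t 1 &
         derive1 (u x) t - kpp (A t) (u ^~ t) x <
         derive1 (v x) t - kpp (A t) (v ^~ t) x]) ->
  forall x, u x b < v x b.
Proof.
move=> cA b0 uvB uvac uv0 uvd x; rewrite -subr_gt0.
have [Ab AAb] := continuous_bounded 0 b cA.
have uv := @kpp_comparison A b B u v cA uvB uvac uv0.
have {}uv y t : 0 <= t <= b -> u y t <= v y t.
  apply: uv => z; apply: ae_impl (uvd z) => s H /H[? ? ?]; split => //; exact: ltW.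
apply: (@abs_cont_gt0 R b (2 * B) (Ab * (1 + 2 * B) + 2) (fun t => v x t - u x t)) => //.
- by apply: abs_contB; [exact: (uvac x).2|exact: (uvac x).1].
- move=> s sb; rewrite subr_ge0 uv//=.
  have [] := uvB x s sb; rewrite !ler_norml => /andP[? ?] /andP[? ?]; lra.
- apply: ae_impl (uvd x) => s H s0b.
  have [du dv uvs] := H s0b.
  have [dw ->] := is_derive_derive1 (is_deriveB1 (derivable_is_derive1 dv) (derivable_is_derive1 du)).
  have sb : 0 <= s <= b by have /andP[? ?] := s0b; rewrite !ltW.
  split => //; exists (A s * (1 - u x s - v x s) - 2).
    by have [? ?] := uvB x s sb; apply: kpp_coeff_bound => //; exact: AAb.
  have := uv (x + 1) s sb; have := uv (x - 1) s sb.
  by have := kppB (A s) (u ^~ s) (v ^~ s) x; lra.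
Qed.

End KPP.

(** * From pointwise to sup norm solutions *)

Section Solutions.
Set Implicit Arguments.
Unset Strict Implicit.
Context {R : realType} {X : pzRingType}.
Implicit Types (u v : X -> R -> R) (A : R -> R) (a b r s t : R).

Lemma derive_lipschitz (f df : R -> R) (C b : R) :
  (forall t, 0 <= t <= b -> is_derive t 1 f (df t) /\ `|df t| <= C) ->
  forall s t, 0 <= s -> s <= t -> t <= b -> `|f t - f s| <= C * (t - s).
Proof.
move=> H s t s0 st tb; rewrite mulrBr.
apply: (@derive_bound R f (fun r => C * r) df (fun=> C)) => // r /andP[sr rt].
have [|fd dfC] := H r; first by lra.
by split => //; exact: is_derive_linear.
Qed.

Lemma exists_coeff (k p r : R) : 0 <= k -> `|p| <= k * `|r| ->
  exists2 c, `|c| <= k & p = c * r.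
Proof.
move=> k0 pr; have [r0|r0] := eqVneq r 0.
  exists 0; rewrite ?normr0// mul0r; apply/eqP.
  by move: pr; rewrite r0 normr0 mulr0 normr_le0.
exists (p / r); last by rewrite divfK.
by rewrite normrM normfV ler_pdivrMr// normr_gt0.
Qed.

(** The radius depends on [p] and [q] only through the bounds [B] and [C], so
    along a bounded flow that is Lipschitz in time the right hand side is
    continuous in time uniformly in [x]. *)
Lemma kpp_time_continuity A t B C : continuous A -> 0 <= B -> 0 <= C -> forall e, 0 < e ->
  exists2 rho, 0 < rho & forall s (p q : X -> R), `|s - t| < rho ->
   (forall y, `|p y| <= B /\ `|q y| <= B) ->
   (forall y, `|p y - q y| <= C * `|s - t|) ->
   forall x, `|kpp (A s) p x - kpp (A t) q x| <= e.
Proof.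
move=> cA B0 C0 e e0.
pose Q := B * (1 + B) + 1.
have BB : 0 <= B * (1 + B) by rewrite mulr_ge0// addr_ge0.
have Q0 : 0 < Q by rewrite ltr_wpDl.
pose K := (4 + (`|A t| + 1) * (1 + 2 * B)) * C + 1.
have K0 : 0 < K by rewrite ltr_wpDl// mulr_ge0// addr_ge0// mulr_ge0// addr_ge0// mulr_ge0.
have eQ : 0 < e / 2 / Q by rewrite !divr_gt0.
have lt01 : 0 < 1 :> R by [].
have /cvgrPdist_lt cAt := cA t.
have /nbhs_ballP[r1/= r10 H1] := cAt _ eQ.
have /nbhs_ballP[r2/= r20 H2] := cAt _ lt01.
exists (Num.min (Num.min r1 r2) (e / 2 / K)).
  by rewrite !lt_min r10 r20 !divr_gt0.
move=> s p q; rewrite !lt_min => /andP[/andP[s1 s2] sK] pqB pqC x.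
have := H1 s; rewrite /ball/= distrC => /(_ s1) A1.
have := H2 s; rewrite /ball/= distrC => /(_ s2) A2.
have As : `|A s| <= `|A t| + 1.
  have := ler_distD (A t) (A s) 0; rewrite !subr0 [`|A s - A t|]distrC; lra.
have dpq : `|kpp (A s) p x - kpp (A s) q x| <= (4 + (`|A t| + 1) * (1 + 2 * B)) * (C * `|s - t|).
  rewrite kppB.
  have [px qx] := pqB x.
  have : `|(A s * (1 - q x - p x) - 2) * (p x - q x)| <=
      ((`|A t| + 1) * (1 + 2 * B) + 2) * (C * `|s - t|).
    by rewrite normrM ler_pM//; exact: kpp_coeff_bound.
  have := pqC (x + 1); have := pqC (x - 1).
  rewrite !ler_norml => /andP[? ?] /andP[? ?] /andP[? ?].
  by apply/andP; split; lra.
have dA : `|kpp (A s) q x - kpp (A t) q x| <= e / 2.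
  have -> : kpp (A s) q x - kpp (A t) q x = (A s - A t) * (q x * (1 - q x)).
    by rewrite /kpp; ring.
  have : `|q x * (1 - q x)| <= Q.
    rewrite normrM (le_trans (ler_pM _ _ _ _ : _ <= B * (1 + B)))// ?lerDl//.
      by have [_] := pqB x.
    by have [_] := pqB x; rewrite !ler_norml => /andP[? ?]; apply/andP; split; lra.
  have -> : e / 2 = (e / 2 / Q) * Q by rewrite divfK// gt_eqF.
  by move=> qQ; rewrite normrM ler_pM// distrC ltW.
have : K * `|s - t| <= e / 2 by rewrite mulrC -ler_pdivlMr// ltW.
have : (4 + (`|A t| + 1) * (1 + 2 * B)) * (C * `|s - t|) <= K * `|s - t|.
  by rewrite mulrA ler_wpM2r// lerDl.
have := ler_distD (kpp (A s) q x) (kpp (A s) p x) (kpp (A t) q x).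
lra.
Qed.

(** The error of the difference quotient of [u x] between [t] and [s] is at most
    the oscillation of its derivative between these times, which is small
    uniformly in [x] by equicontinuity. *)
Lemma kpp_flow_is_solution A u : continuous A ->
  (forall x t, 0 <= t -> is_derive t 1 (u x) (kpp (A t) (u ^~ t) x)) ->
  (forall b, exists B, forall x t, 0 <= t <= b -> `|u x t| <= B) ->
  is_solution A (u ^~ 0) +oo u.
Proof.
move=> cA ud ub; split => //.
  by move=> t [t0 _]; apply/linfP; have [B uB] := ub t; exists B => x; rewrite uB// t0 lexx.
move=> t [t0 _].
have tt1 : 0 <= t <= t + 1 by apply/andP; split; lra.
have [B uB] := ub (t + 1); have [Ab AAb] := continuous_bounded 0 (t + 1) cA.
have B0 : 0 <= B by exact: le_trans (uB 0 t tt1).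
have Ab0 : 0 <= Ab by exact: le_trans (AAb t tt1).
pose C := 4 * B + Ab * (B * (1 + B)).
have C0 : 0 <= C by rewrite addr_ge0// mulr_ge0// mulr_ge0// addr_ge0.
have lip x s r : 0 <= s -> s <= r -> r <= t + 1 -> `|u x r - u x s| <= C * (r - s).
  apply: (@derive_lipschitz (u x) (fun t => kpp (A t) (u ^~ t) x)) => q q01.
  split; first by have /andP[? _] := q01; exact: ud.
  by apply: kpp_bound; [exact: AAb|move=> y; exact: uB].
have lip' x s : 0 <= s -> s <= t + 1 -> `|u x s - u x t| <= C * `|s - t|.
  move=> s0 st1; have [st|ts] := leP s t.
    by rewrite distrC [`|s - t|]distrC [`|t - s|]ger0_norm ?subr_ge0// lip// lerDl.
  by rewrite [`|s - t|]ger0_norm ?subr_ge0 ?(ltW ts)// lip// ltW.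
apply/cvgrPdist_lt => e e0.
have e2 : 0 < e / 2 by rewrite divr_gt0.
have [rho rho0 H] := kpp_time_continuity t cA B0 C0 e2.
apply/nbhs_ballP; exists (Num.min rho 1); first by rewrite /= lt_min rho0 ltr01.
move=> s; rewrite /ball/= distrC lt_min => /andP[srho s1] st [s0 _].
have key x : `|(u x s - u x t) / (s - t) - kpp (A t) (u ^~ t) x| <= e / 2.
  have st0 : s - t != 0 by rewrite subr_eq0.
  have deriv r : 0 <= r -> is_derive r 1 (fun r => u x r - kpp (A t) (u ^~ t) x * r)
      (kpp (A r) (u ^~ r) x - kpp (A t) (u ^~ t) x).
    by move=> r0; apply: is_deriveB1; [exact: ud|exact: is_derive_linear].
  have small r : 0 <= r -> `|r - t| <= `|s - t| ->
      `|kpp (A r) (u ^~ r) x - kpp (A t) (u ^~ t) x| <= e / 2.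
    move=> r0 rs; have rt1 : r <= t + 1.
      by move: (le_lt_trans rs s1); rewrite ltr_norml => /andP[_]; lra.
    apply: (H r (u ^~ r) (u ^~ t)).
    - exact: le_lt_trans srho.
    - by move=> y; split; apply: uB => //; rewrite r0.
    - by move=> y; exact: lip'.
  have -> : (u x s - u x t) / (s - t) - kpp (A t) (u ^~ t) x =
     ((u x s - kpp (A t) (u ^~ t) x * s) - (u x t - kpp (A t) (u ^~ t) x * t)) / (s - t).
    by field.
  rewrite normrM normfV ler_pdivrMr ?normr_gt0//.
  have bound a b : 0 <= a -> a <= b -> (forall r, a <= r <= b -> `|r - t| <= `|s - t|) ->
     `|(u x b - kpp (A t) (u ^~ t) x * b) - (u x a - kpp (A t) (u ^~ t) x * a)| <= e / 2 * (b - a).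
    move=> a0 ab near; rewrite mulrBr.
    apply: (@derive_bound R (fun r => u x r - kpp (A t) (u ^~ t) x * r) (fun r => e / 2 * r)
      (fun r => kpp (A r) (u ^~ r) x - kpp (A t) (u ^~ t) x) (fun=> e / 2)) => // r rab.
    have r0 : 0 <= r by have /andP[? _] := rab; exact: le_trans a0 _.
    split; [exact: deriv|exact: is_derive_linear|].
    by apply: small => //; exact: near.
  have [ts|ts] := leP s t.
    rewrite distrC [`|s - t|]distrC [`|t - s|]ger0_norm ?subr_ge0//.
    apply: bound => // r /andP[sr rt].
    by rewrite distrC [`|s - t|]distrC !ger0_norm ?subr_ge0//; lra.
  rewrite [`|s - t|]ger0_norm ?subr_ge0 ?(ltW ts)//.
  apply: bound => //; first exact: ltW.
  by move=> r /andP[tr rs]; rewrite !ger0_norm ?subr_ge0 ?(ltW ts)//; lra.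
have /andP[n0 ne] := linf_norm_le key.
by rewrite sub0r normrN ger0_norm//; lra.
Qed.

Definition clip (M r : R) := Num.max 0 (Num.min r M).

Lemma clip_id M r : 0 <= r <= M -> clip M r = r.
Proof. by move=> /andP[r0 rM]; rewrite /clip (min_idPl rM) (max_idPr r0). Qed.

Lemma clip_lip M r s : `|clip M r - clip M s| <= `|r - s|.
Proof.
have max_lip (p q : R) : `|Num.max 0 p - Num.max 0 q| <= `|p - q|.
  by case: (leP 0 p) => ?; case: (leP 0 q) => ?; rewrite ler_norml;
    case: (lerP p q) => ?; apply/andP; split; lra.
apply: le_trans (max_lip _ _) _.
by case: (leP r M) => ?; case: (leP s M) => ?; rewrite ler_norml;
  case: (lerP r s) => ?; apply/andP; split; lra.
Qed.

End Solutions.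

(** * Global existence, nonnegativity and uniqueness *)

Section Global.
Set Implicit Arguments.
Unset Strict Implicit.
Context {R : realType} {X : pzRingType}.
Implicit Types (u v : X -> R -> R) (A : R -> R) (a b r s t : R) (T : \bar R).

Definition logistic r : R := r * (1 - r).

Lemma logistic_clip_lip M r s : 0 <= M ->
  `|logistic (clip M r) - logistic (clip M s)| <= (1 + 2 * M) * `|r - s|.
Proof.
move=> M0; rewrite /logistic.
have clipM q : 0 <= clip M q <= M.
  by rewrite /clip le_max lexx/= ge_max M0/= ge_min lexx orbT.
have -> : clip M r * (1 - clip M r) - clip M s * (1 - clip M s) =
  (1 - clip M r - clip M s) * (clip M r - clip M s) by ring.
rewrite normrM ler_pM// ?clip_lip//.
have /andP[? ?] := clipM r; have /andP[? ?] := clipM s.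
by rewrite ler_norml; apply/andP; split; lra.
Qed.

(** The constant [M >= 1] is a super-solution because [logistic M <= 0] and
    [0] is a solution, also for the truncated reaction term; hence the truncated
    flow stays in [[0, M]], where the truncation is inactive. *)
Lemma nonneg_solution_exists A (u0 : X -> R) : continuous A -> (forall t, 0 < A t) ->
  linf_pos u0 ->
  exists2 u, is_solution A u0 +oo u & forall x t, 0 <= t -> 0 <= u x t.
Proof.
move=> cA A0 [/linfP[B0 u0B] infu0].
have u00 x : 0 <= u0 x.
  apply: le_trans infu0 _; apply: ge_inf; last by exists x.
  by exists (- B0) => _ [y _ <-]; have := u0B y; rewrite ler_norml => /andP[].
pose M := Num.max 1 B0.
have M1 : 1 <= M by rewrite le_max lexx.
have M0 : 0 <= M by exact: le_trans M1.
have u0M x : u0 x <= M.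
  by rewrite (le_trans (ler_norm _))// (le_trans (u0B x))// le_max lexx orbT.
have k0 : 0 <= 1 + 2 * M by lra.
pose psi r := logistic (clip M r).
have lip r s : `|psi r - psi s| <= (1 + 2 * M) * `|r - s| by exact: logistic_clip_lip.
have [U [U0 Ud UB]] := picard_solution cA lip u0B.
have Uac b x : abs_cont 0 b (U x).
  have [B HB] := UB b; have [Ab AAb] := continuous_bounded 0 b cA.
  apply: lipschitz_abs_cont; apply: (@derive_lipschitz _ _ (field A psi U x)) => t tb.
  have /andP[t0 _] := tb; split; first exact: Ud.
  by apply: (field_bound lip); [exact: AAb|move=> y; exact: HB].
have psi0 : psi 0 = 0 by rewrite /psi clip_id ?lexx// /logistic mul0r.
have Uge0 x t : 0 <= t -> 0 <= U x t.
  move=> t0; have [B HB] := UB t; have [Ab AAb] := continuous_bounded 0 t cA.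
  apply: (@linear_comparison R X t B (Ab * (1 + 2 * M) + 2) U) => //.
  - by move=> y s /(HB y); rewrite ler_norml => /andP[].
  - by move=> y; rewrite U0.
  - move=> y; apply: aeW => s /andP[s0 st].
    have [dU ->] := is_derive_derive1 (Ud y s (ltW s0)); split => //.
    have := lip (U y s) 0; rewrite psi0 !subr0 => /(exists_coeff k0)[c ck cE].
    exists (A s * c - 2); last by rewrite /field /Hop cE; lra.
    have : `|A s * c| <= Ab * (1 + 2 * M).
      by rewrite normrM ler_pM//; apply: AAb; rewrite !ltW.
    by rewrite !ler_norml => /andP[? ?]; apply/andP; split; lra.
  - by rewrite t0 lexx.
have UleM x t : 0 <= t -> U x t <= M.
  move=> t0; have [B HB] := UB t; have [Ab AAb] := continuous_bounded 0 t cA.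
  rewrite -subr_ge0.
  apply: (@linear_comparison R X t (B - M) (Ab * (1 + 2 * M) + 2) (fun x t => M - U x t)).
  - move=> y; apply: abs_contB => //; apply: (@lipschitz_abs_cont _ _ _ 0) => p q _ pq _.
    by rewrite subrr normr0 mul0r.
  - by move=> y s /(HB y); rewrite ler_norml => /andP[? ?]; lra.
  - by move=> y; rewrite subr_ge0 U0.
  - move=> y; apply: aeW => s /andP[s0 st].
    have [dU ->] := is_derive_derive1 (is_deriveB1 (is_derive_cst M s 1) (Ud y s (ltW s0))).
    split => //.
    have := lip M (U y s) => /(exists_coeff k0)[c ck cE].
    exists (A s * c - 2); last first.
      have psiM : psi M <= 0.
        by rewrite /psi clip_id ?lexx ?M0// /logistic mulr_ge0_le0// subr_le0.
      have := mulr_ge0_le0 (ltW (A0 s)) psiM.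
      have : A s * psi (U y s) = A s * psi M - A s * (c * (M - U y s)) by rewrite -cE; ring.
      by rewrite /field /Hop; lra.
    have : `|A s * c| <= Ab * (1 + 2 * M).
      by rewrite normrM ler_pM//; apply: AAb; rewrite !ltW.
    by rewrite !ler_norml => /andP[? ?]; apply/andP; split; lra.
  - by rewrite t0 lexx.
exists U => //.
have Ukpp x t : 0 <= t -> is_derive t 1 (U x) (kpp (A t) (U ^~ t) x).
  move=> t0; suff <- : field A psi U x t = kpp (A t) (U ^~ t) x by exact: Ud.
  by rewrite /field /kpp /psi clip_id ?Uge0 ?UleM// /logistic mulrA.
have <- : U ^~ 0 = u0 by apply/funext.
exact: (kpp_flow_is_solution cA Ukpp UB).
Qed.

(** The sup norm limit read pointwise, with a radius independent of [x].  The
    quotient has to be bounded in [x] for its sup norm to dominate its values,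
    the supremum of an unbounded set being [0] by convention. *)
Lemma solution_increment A (u0 : X -> R) T v t : is_solution A u0 T v -> time_dom T t ->
  forall e, 0 < e -> exists2 rho, 0 < rho & forall s, time_dom T s -> `|s - t| < rho ->
    forall x, `|v x s - v x t - kpp (A t) (v ^~ t) x * (s - t)| <= e * `|s - t|.
Proof.
move=> [_ vlinf vd] Tt e e0.
have /cvgrPdist_lt/(_ e e0) := vd t Tt.
move=> /nbhs_ballP[rho/= rho0 H]; exists rho => // s Ts st x.
have [->|sNt] := eqVneq s t; first by rewrite !subrr mulr0 normr0 mulr0 subrr normr0.
have st0 : s - t != 0 by rewrite subr_eq0.
have := H s; rewrite /ball/= distrC => /(_ st sNt Ts).
rewrite sub0r normrN => lt_e.
pose q y := (v y s - v y t) / (s - t) - kpp (A t) (v ^~ t) y.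
have qlinf : linf q.
  have /linfP[B1 H1] := vlinf s Ts; have /linfP[B2 H2] := vlinf t Tt.
  apply/linfP; exists ((B1 + B2) / `|s - t| + (4 * B2 + `|A t| * (B2 * (1 + B2)))) => y.
  rewrite /q (le_trans (ler_normB _ _))// lerD//; last exact: kpp_bound.
  by rewrite normrM normfV ler_wpM2r ?invr_ge0// (le_trans (ler_normB _ _))// lerD.
have -> : v x s - v x t - kpp (A t) (v ^~ t) x * (s - t) = q x * (s - t).
  by rewrite /q; field.
rewrite normrM ler_wpM2r// (le_trans (ler_linf_norm x qlinf))//.
by rewrite (le_trans (ler_norm _))// ltW.
Qed.

(** Boundedness of each time slice propagates to compact time intervals because
    near every time [c] all the slices stay within a bounded distance of the
    slice at [c]. *)
Lemma solution_bounded A (u0 : X -> R) T v b : is_solution A u0 T v -> time_dom T b ->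
  exists B, forall x t, 0 <= t <= b -> `|v x t| <= B.
Proof.
move=> vsol Tb; have [b0 _] := Tb; have [_ vlinf _] := vsol.
apply: (@gauge_induction R 0 b (fun y => exists B, forall x t, 0 <= t <= y -> `|v x t| <= B)) => //.
  have T0 : time_dom T 0 by apply: time_dom_le Tb _; rewrite lexx.
  have /linfP[B HB] := vlinf 0 T0.
  by exists B => x t; rewrite -eq_le => /eqP <-.
move=> c c0b; have Tc := time_dom_le Tb c0b.
have /linfP[B HB] := vlinf c Tc.
have [rho rho0 H] := solution_increment vsol Tc (@ltr01 R).
pose K := 4 * B + `|A c| * (B * (1 + B)).
exists rho => // s y /andP[s0 sc] /andP[cy yb] cs yc [B' HB'].
exists (Num.max B' (B + (K + 1) * rho)) => x t /andP[t0 ty].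
rewrite le_max; have [ts|st] := leP t s; first by rewrite HB'// t0.
apply/orP; right.
have tc : `|t - c| < rho by rewrite ltr_norml; apply/andP; split; lra.
have Tt : time_dom T t by apply: time_dom_le Tb _; rewrite t0 (le_trans ty).
have := H t Tt tc x; rewrite mul1r => Ht.
have Kc : `|kpp (A c) (v ^~ c) x| <= K by exact: kpp_bound.
have K0 : 0 <= K by exact: le_trans Kc.
have : `|kpp (A c) (v ^~ c) x * (t - c)| <= K * `|t - c| by rewrite normrM ler_wpM2r.
have : (K + 1) * `|t - c| <= (K + 1) * rho by apply: ler_wpM2l; [rewrite addr_ge0|exact: ltW].
have := HB x; have := ler_norm (t - c); move: Ht.
rewrite !ler_norml => /andP[? ?] _ /andP[? ?] ? /andP[? ?].
by apply/andP; split; lra.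
Qed.

(** Near each time the increments of [v x] are at most [K + 1] times the elapsed
    time, [K] bounding the right hand side; the gauge induction adds them up to
    a Lipschitz estimate without differentiability on both sides at [0]. *)
Lemma solution_regular A (u0 : X -> R) T v b B x : continuous A -> is_solution A u0 T v ->
  time_dom T b -> (forall x t, 0 <= t <= b -> `|v x t| <= B) ->
  abs_cont 0 b (v x) /\
  forall t, 0 < t < b -> is_derive t 1 (v x) (kpp (A t) (v ^~ t) x).
Proof.
move=> cA vsol Tb vB; have [b0 _] := Tb.
have [Ab AAb] := continuous_bounded 0 b cA.
pose K := 4 * B + Ab * (B * (1 + B)).
have kB t y : 0 <= t <= b -> `|kpp (A t) (v ^~ t) y| <= K.
  by move=> tb; apply: kpp_bound; [exact: AAb|move=> z; exact: vB].
split.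
  apply: (@lipschitz_abs_cont _ _ _ (K + 1)) => s y s0 sy yb.
  apply: (@gauge_induction R s y (fun y => `|v x y - v x s| <= (K + 1) * (y - s))) => //.
    by rewrite !subrr normr0 mulr0.
  move=> c /andP[sc cy]; have c0b : 0 <= c <= b by rewrite (le_trans s0 sc) (le_trans cy).
  have [rho rho0 H] := solution_increment vsol (time_dom_le Tb c0b) (@ltr01 R).
  have H' r : s <= r -> r <= y -> `|r - c| < rho -> `|v x r - v x c| <= (K + 1) * `|r - c|.
    move=> sr ry rc; have Tr : time_dom T r.
      by apply: time_dom_le Tb _; rewrite (le_trans s0 sr) (le_trans ry).
    have := H r Tr rc x; rewrite mul1r.
    have : `|kpp (A c) (v ^~ c) x * (r - c)| <= K * `|r - c| by rewrite normrM ler_wpM2r// kB.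
    rewrite !ler_norml => /andP[? ?] /andP[? ?].
    by apply/andP; split; lra.
  exists rho => // p q /andP[sp pc] /andP[cq qy] cp qc Hp.
  have := H' p sp (le_trans pc cy); rewrite ltr_norml => /(_ _)/wrap[].
    by apply/andP; split; lra.
  have := H' q (le_trans sc cq) qy; rewrite ltr_norml => /(_ _)/wrap[].
    by apply/andP; split; lra.
  rewrite (ger0_norm (_ : 0 <= q - c)) ?subr_ge0// (ler0_norm (_ : p - c <= 0)) ?subr_le0//.
  by move: Hp; rewrite !ler_norml => /andP[? ?] /andP[? ?] /andP[? ?]; apply/andP; split; lra.
move=> t /andP[t0 tb]; apply: near_is_derive => e e0.
have tb' : 0 <= t <= b by rewrite !ltW.
have [rho rho0 H] := solution_increment vsol (time_dom_le Tb tb') e0.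
exists (Num.min rho (Num.min t (b - t))); first by rewrite !lt_min rho0 t0 subr_gt0.
move=> y; rewrite !lt_min => /andP[yrho /andP[yt ybt]].
apply: H => //; apply: time_dom_le Tb _.
by move: yt ybt; rewrite !ltr_norml => /andP[? ?] /andP[? ?]; apply/andP; split; lra.
Qed.

Lemma solution_le A (u0 : X -> R) T u v : continuous A ->
  is_solution A u0 T u -> is_solution A u0 T v ->
  forall x t, time_dom T t -> u x t <= v x t.
Proof.
move=> cA usol vsol x t Tt.
have [t0 _] := Tt.
have [Bu uB] := solution_bounded usol Tt; have [Bv vB] := solution_bounded vsol Tt.
apply: (@kpp_comparison R X A t (Num.max Bu Bv)) => //; last by rewrite t0 lexx.
- by move=> y s sb; split; rewrite le_max; [rewrite uB|rewrite vB ?orbT].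
- by move=> y; split; [exact: (solution_regular y cA usol Tt uB).1|
                       exact: (solution_regular y cA vsol Tt vB).1].
- move=> y; have [u0E _ _] := usol; have [v0E _ _] := vsol.
  by have := congr1 (fun f => f y) u0E; rewrite -v0E => /= ->.
- move=> y; apply: aeW => s s0t.
  have [du ->] := is_derive_derive1 ((solution_regular y cA usol Tt uB).2 s s0t).
  have [dv ->] := is_derive_derive1 ((solution_regular y cA vsol Tt vB).2 s s0t).
  by rewrite !subrr.
Qed.

Lemma is_solution_restrict A (u0 : X -> R) T u : is_solution A u0 +oo u -> is_solution A u0 T u.
Proof.
move=> [u0E ul ud].
have sub : time_dom T `<=` time_dom +oo%E by move=> t [t0 _]; split; rewrite ?ltry.
split => // [t /sub/ul //|t /[dup] /sub Tt _].
apply: cvg_trans (ud t Tt).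
by apply: cvg_app; apply: within_subset => //; exact: sub.
Qed.

Theorem global_solution A (u0 : X -> R) : continuous A -> (forall t, 0 < A t) ->
  linf_pos u0 ->
  exists2 u, is_the_global_solution A u0 u & forall x t, 0 <= t -> 0 <= u x t.
Proof.
move=> cA A0 /(nonneg_solution_exists cA A0)[u usol u_ge0].
exists u => //; split => // T v _ vsol x t Tt.
have uT := is_solution_restrict T usol.
by apply/eqP; rewrite eq_le (solution_le cA vsol uT)// (solution_le cA uT vsol).
Qed.

End Global.

(** * Random sub- and super-solutions *)

Section SubSuper.
Set Implicit Arguments.
Unset Strict Implicit.
Context {R : realType} {X : pzRingType} (d : measure_display)
  (Omega : measurableType d) (P : probability Omega R)
  (theta : R -> Omega -> Omega) (a : Omega -> R).
Hypothesis a_cont : forall w, continuous (fun t => a (theta t w)).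

Lemma sub_super_comparison (T : \bar R) (u1 u2 : Omega -> X -> R -> R) :
  sub_solution P theta a T u1 -> super_solution P theta a T u2 ->
  \forall w \ae P,
    bounded_dom T (u1 w) -> bounded_dom T (u2 w) ->
    (forall x, u1 w x 0 <= u2 w x 0) ->
    forall x t, time_dom T t -> u1 w x t <= u2 w x t.
Proof.
move=> [_ sub] [_ super].
have aeF := ae_filter_ringOfSetsType P.
apply: filterS2 sub super => w sub super /bounded_domP[B1 HB1] /bounded_domP[B2 HB2] le0 x t Tt.
have [t0 _] := Tt.
have inT s : 0 <= s <= t -> time_dom T s by exact: time_dom_le.
apply: (@kpp_comparison R X (fun t => a (theta t w)) t (Num.max B1 B2)) => //.
- by move=> y s /inT Ts; split; rewrite le_max; [rewrite HB1|rewrite HB2 ?orbT].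
- by move=> y; split; [exact: (sub y).1|exact: (super y).1].
- move=> y; have aeL := ae_filter_ringOfSetsType (@lebesgue_measure R).
  apply: filterS2 (sub y).2 (super y).2 => s H1 H2 /andP[s0 st].
  have Ts : time_dom T s by apply: inT; rewrite !ltW.
  have [du1 le1] := H1 Ts; have [du2 ge2] := H2 Ts.
  by split => //; apply: (@le_trans _ _ 0); rewrite ?subr_le0 ?subr_ge0.
- by rewrite t0 lexx.
Qed.

Lemma strict_sub_super_comparison (u1 u2 : Omega -> X -> R -> R) :
  \forall w \ae P,
    bounded_dom +oo%E (u1 w) -> bounded_dom +oo%E (u2 w) ->
    (forall x, [/\ abs_cont_dom +oo%E (u1 w x),
       abs_cont_dom +oo%E (u2 w x) &
       \forall t \ae lebesgue_measure, 0 < t ->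
         [/\ derivable (u1 w x) t 1, derivable (u2 w x) t 1 &
             derive1 (u2 w x) t - kpp (a (theta t w)) (u2 w ^~ t) x >
             derive1 (u1 w x) t - kpp (a (theta t w)) (u1 w ^~ t) x]]) ->
    (forall x, u2 w x 0 >= u1 w x 0) ->
    forall x t, 0 < t -> u2 w x t > u1 w x t.
Proof.
apply: aeW => w /bounded_domP[B1 HB1] /bounded_domP[B2 HB2] H le0 x t t0.
have inT s : 0 <= s -> time_dom +oo%E s by move=> s0; split; rewrite ?ltry.
apply: (@kpp_strict_comparison R X (fun t => a (theta t w)) t (Num.max B1 B2)) => //.
- by move=> y s /andP[/inT Ts _]; split; rewrite le_max; [rewrite HB1|rewrite HB2 ?orbT].
- by move=> y; have [ac1 ac2 _] := H y; split; [apply: ac1|apply: ac2]; apply/inT/ltW.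
- move=> y; have [_ _ ae12] := H y.
  by apply: ae_impl ae12 => s Hs /andP[s0 _]; exact: Hs.
Qed.

End SubSuper.

Theorem proposition2p1 (R : realType) (d : measure_display)
    (Omega : measurableType d) (P : probability Omega R)
    (theta : R -> Omega -> Omega) (a : Omega -> R)
    (theta_mds : ergodic_mds P theta)
    (a_pos : forall w, 0 < a w)
    (a_meas : measurable_fun [set: Omega] a)
    (a_hoelder : forall w, locally_hoelder (fun t => a (theta t w)))
    (a_means : \forall w \ae P,
       [/\ (0 < lower_mean (fun t => a (theta t w)))%E,
           (lower_mean (fun t => a (theta t w))
              <= upper_mean (fun t => a (theta t w)))%E &
           (upper_mean (fun t => a (theta t w)) < +oo)%E]) :
  (forall (T : \bar R) (u1 u2 : Omega -> R -> R -> R),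
     (0 < T)%E ->
     sub_solution P theta a T u1 -> super_solution P theta a T u2 ->
     \forall w \ae P,
       bounded_dom T (u1 w) -> bounded_dom T (u2 w) ->
       (forall x, u1 w x 0 <= u2 w x 0) ->
       forall x t, time_dom T t -> u1 w x t <= u2 w x t) /\
  (forall (T : \bar R) (u1 u2 : Omega -> int -> R -> R),
     (0 < T)%E ->
     sub_solution P theta a T u1 -> super_solution P theta a T u2 ->
     \forall w \ae P,
       bounded_dom T (u1 w) -> bounded_dom T (u2 w) ->
       (forall x, u1 w x 0 <= u2 w x 0) ->
       forall x t, time_dom T t -> u1 w x t <= u2 w x t) /\
  (forall (u1 u2 : Omega -> R -> R -> R),
     \forall w \ae P,
       bounded_dom +oo%E (u1 w) -> bounded_dom +oo%E (u2 w) ->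
       (forall x, [/\ abs_cont_dom +oo%E (u1 w x),
          abs_cont_dom +oo%E (u2 w x) &
          \forall t \ae lebesgue_measure, 0 < t ->
            [/\ derivable (u1 w x) t 1, derivable (u2 w x) t 1 &
                derive1 (u2 w x) t - kpp (a (theta t w)) (u2 w ^~ t) x >
                derive1 (u1 w x) t - kpp (a (theta t w)) (u1 w ^~ t) x]]) ->
       (forall x, u2 w x 0 >= u1 w x 0) ->
       forall x t, 0 < t -> u2 w x t > u1 w x t) /\
  (forall (u1 u2 : Omega -> int -> R -> R),
     \forall w \ae P,
       bounded_dom +oo%E (u1 w) -> bounded_dom +oo%E (u2 w) ->
       (forall x, [/\ abs_cont_dom +oo%E (u1 w x),
          abs_cont_dom +oo%E (u2 w x) &
          \forall t \ae lebesgue_measure, 0 < t ->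
            [/\ derivable (u1 w x) t 1, derivable (u2 w x) t 1 &
                derive1 (u2 w x) t - kpp (a (theta t w)) (u2 w ^~ t) x >
                derive1 (u1 w x) t - kpp (a (theta t w)) (u1 w ^~ t) x]]) ->
       (forall x, u2 w x 0 >= u1 w x 0) ->
       forall x t, 0 < t -> u2 w x t > u1 w x t) /\
  (forall (w : Omega) (u0 : R -> R), linf_pos u0 ->
     exists2 u : R -> R -> R,
       is_the_global_solution (fun t => a (theta t w)) u0 u &
       forall x t, 0 <= t -> 0 <= u x t) /\
  (forall (w : Omega) (u0 : int -> R), linf_pos u0 ->
     exists2 u : int -> R -> R,
       is_the_global_solution (fun t => a (theta t w)) u0 u &
       forall x t, 0 <= t -> 0 <= u x t).
Proof.
have a_cont w : continuous (fun t => a (theta t w)).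
  exact: locally_hoelder_continuous.
have a_gt0 w t : 0 < a (theta t w) by exact: a_pos.
split; first by move=> T u1 u2 _; exact: sub_super_comparison.
split; first by move=> T u1 u2 _; exact: sub_super_comparison.
split; first exact: strict_sub_super_comparison.
split; first exact: strict_sub_super_comparison.
by split=> w u0 u0_pos; apply: global_solution => //; exact: a_gt0.
Qed.
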